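(* Let $p$ be a prime and let $G$ be a free pro-$p$ group of infinite rank. Then for every ordinal $\alpha$, the group $G_\alpha$ (the profinite completion of $G$ of order $\alpha$) is a free pro-$p$ group.
   Context: For an infinite cardinal $\mathbf{m}$, the free pro-$p$ group of rank $\mathbf{m}$ is the free pro-$p$ group on a set $X$ converging to $1$ with $|X|=\mathbf{m}$: it is a pro-$p$ group $F$ with a continuous pointed map $i:X\cup\{\ast\}\to F$ from the one-point compactification of the discrete space $X$ (with $\ast\mapsto 1$), such that every continuous pointed map $f:X\cup\{\ast\}\to H$ to a pro-$p$ group $H$ (with $\ast\mapsto 1$) factors as $f=\bar f\circ i$ for a unique continuous homomorphism $\bar f:F\to H$. (The same definition applies to any cardinal, with $\ast$ an isolated point when $X$ is finite.) For an abstract group $\Gamma$, $\widehat{\Gamma}$ denotes its profinite completion, i.e. the inverse limit of all its finite quotients, with canonical homomorphism $\Gamma\to\widehat\Gamma$. A profinite group, regarded as an abstract group, has a profinite completion; it is called strongly complete if it equals its profinite completion, equivalently if every subgroup of finite index is open. A free pro-$p$ group of infinite rank is not strongly complete. Completions of higher order: for a nonstrongly complete profinite group $G$, define groups $G_\alpha$ and compatible homomorphisms $\varphi_{\gamma\beta}:G_\gamma\to G_\beta$ ($\gamma<\beta$) by transfinite recursion: $G_0=G$; if $\alpha=\beta+1$ then $G_\alpha=\widehat{G_\beta}$ (completion of $G_\beta$ as an abstract group), with $\varphi_{\beta\alpha}$ the canonical map and the other maps obtained by composition; if $\alpha$ is a limit ordinal then $G_\alpha=\widehat{H_\alpha}$,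 where $H_\alpha=\varinjlim_{\beta<\alpha}\{G_\beta,\varphi_{\gamma\beta}\}$ is the direct limit of abstract groups, and $\varphi_{\beta\alpha}$ is the composition $G_\beta\to H_\alpha\to\widehat{H_\alpha}$. *)

(* Defs.v *)
From HB Require Import structures.
From mathcomp Require Import all_boot all_order generic_quotient.
From mathcomp Require Import all_classical wochoice topology.

Set Implicit Arguments.
Unset Strict Implicit.
Unset Printing Implicit Defensive.

Import Order.TTheory.
Local Open Scope order_scope.
Local Open Scope group_scope.
Local Open Scope quotient_scope.
Local Open Scope classical_set_scope.

HB.mixin Record isTopologicalGroup G & Group G & Topological G := {
  mulg_continuous : continuous (fun xy : G * G => xy.1 * xy.2 : G);
  invg_continuous : continuous (fun x : G => x^-1) }.

#[short(type="topGroupType")]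
HB.structure Definition TopologicalGroup :=
  { G of isTopologicalGroup G & Group G & Topological G }.

Section Cosets.
Context {Gam : groupType}.
Implicit Types (N C D : set Gam) (g h : Gam).

Definition normal_subgroup N : Prop :=
  [/\ N 1, forall x y, N x -> N y -> N (x * y), forall x, N x -> N x^-1
    & forall x g, N x -> N (g^-1 * x * g)].

Definition lcoset N g : set Gam := [set g * x | x in N].

Definition cosets N : set (set Gam) := range (lcoset N).

Lemma mem_lcoset N g h : lcoset N g h <-> N (g^-1 * h).
Proof.
split=> [[x Nx <-]|Nh]; first by rewrite mulgA mulVg mul1g.
by exists (g^-1 * h) => //; rewrite mulgA mulgV mul1g.
Qed.

End Cosets.

Definition profinite (G : topGroupType) : Prop :=
  [/\ compact [set: G], hausdorff_space G & totally_disconnected [set: G]].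

Definition pro_p (p : nat) (G : topGroupType) : Prop :=
  profinite G /\ forall N : set G, normal_subgroup N -> open N ->
    exists k, (cosets N #= `I_(p ^ k)%N)%card.

(* For X finite, [None] is isolated in [one_point_compactification X]. *)
Definition free_pro_p_on (p : nat) (X : discreteTopologicalType)
    (F : topGroupType) (i : one_point_compactification X -> F) : Prop :=
  [/\ pro_p p F, continuous i, i None = 1
    & forall (H : topGroupType) (f : one_point_compactification X -> H),
        pro_p p H -> continuous f -> f None = 1 ->
        exists! fbar : F -> H,
          [/\ continuous fbar, {morph fbar : x y / x * y} & f = fbar \o i]].

Definition free_pro_p (p : nat) (F : topGroupType) : Prop :=
  exists (X : discreteTopologicalType) (i : one_point_compactification X -> F),
    free_pro_p_on p i.

Definition free_pro_p_of_infinite_rank (p : nat) (F : topGroupType) : Prop :=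
  exists (X : discreteTopologicalType) (i : one_point_compactification X -> F),
    infinite_set [set: X] /\ free_pro_p_on p i.

Record fin_normal (Gam : groupType) := FinNormal {
  fin_normal_set :> set Gam;
  fin_normalP : normal_subgroup fin_normal_set;
  fin_normal_finite : finite_set (cosets fin_normal_set) }.

HB.instance Definition _ (Gam : groupType) := gen_eqMixin (fin_normal Gam).
HB.instance Definition _ (Gam : groupType) := gen_choiceMixin (fin_normal Gam).

Definition quot (Gam : groupType) (N : fin_normal Gam) : Type :=
  set_type (cosets N).

HB.instance Definition _ (Gam : groupType) (N : fin_normal Gam) :=
  Choice.copy (quot N) (set_type (cosets N)).

Section QuotGroup.
Context {Gam : groupType} (N : fin_normal Gam).
Implicit Types (C D : quot N) (g h : Gam).

Lemma lcosetP g : lcoset N g \in cosets N.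
Proof. by rewrite inE; exists g. Qed.

Definition to_quot g : quot N := SigSub (lcosetP g).

Lemma to_quot_ex C : exists g, to_quot g = C.
Proof.
by case: C => C CP; have := CP; rewrite inE => -[g _ eC]; exists g; exact/val_inj.
Qed.

Lemma to_quot_eq g h : to_quot g = to_quot h <-> fin_normal_set N (g^-1 * h).
Proof.
have [N1 NM NV NJ] := fin_normalP N.
split=> [/(congr1 val) /= e|Ngh].
  by apply/mem_lcoset; rewrite e; apply/mem_lcoset; rewrite mulVg.
apply/val_inj => /=; apply/seteqP; split=> x /mem_lcoset Nx; apply/mem_lcoset.
  suff -> : h^-1 * x = (g^-1 * h)^-1 * (g^-1 * x) by apply: NM => //; exact: NV.
  by rewrite invgM invgK mulgA -[_ * g * _]mulgA mulgV mulg1.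
suff -> : g^-1 * x = (g^-1 * h) * (h^-1 * x) by apply: NM.
by rewrite mulgA -[_ * h * _]mulgA mulgV mulg1.
Qed.

Definition quot_repr C : Gam := sval (cid (to_quot_ex C)).

Lemma quot_reprK : cancel quot_repr to_quot.
Proof. by move=> C; rewrite /quot_repr; case: cid. Qed.

Definition quot_one : quot N := to_quot 1.
Definition quot_mul C D : quot N := to_quot (quot_repr C * quot_repr D).
Definition quot_inv C : quot N := to_quot (quot_repr C)^-1.

Lemma to_quotM g h : to_quot (g * h) = quot_mul (to_quot g) (to_quot h).
Proof.
have [N1 NM NV NJ] := fin_normalP N.
have /to_quot_eq Ng := esym (quot_reprK (to_quot g)).
have /to_quot_eq Nh := esym (quot_reprK (to_quot h)).
rewrite /quot_mul; apply/to_quot_eq.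
move: (quot_repr (to_quot g)) (quot_repr (to_quot h)) Ng Nh => g' h' Ng Nh.
suff -> : (g * h)^-1 * (g' * h') = (h^-1 * (g^-1 * g') * h) * (h^-1 * h').
  by apply: NM => //; exact: NJ.
by rewrite invgM !mulgA -[_ * h * h^-1]mulgA mulgV mulg1.
Qed.

Lemma to_quotV g : to_quot g^-1 = quot_inv (to_quot g).
Proof.
have [N1 NM NV NJ] := fin_normalP N.
have /to_quot_eq Ng := esym (quot_reprK (to_quot g)).
rewrite /quot_inv; apply/to_quot_eq; move: (quot_repr _) Ng => g' Ng.
suff -> : g^-1^-1 * g'^-1 = (g^-1)^-1 * (g^-1 * g')^-1 * g^-1.
  by apply: NJ; exact: NV.
by rewrite invgM invgK !mulgA -[_ * g * g^-1]mulgA mulgV mulg1.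
Qed.

Lemma quot_mulA : associative quot_mul.
Proof.
move=> C D E; case: (to_quot_ex C) (to_quot_ex D) (to_quot_ex E) => g <- [h <-] [k <-].
by rewrite -!to_quotM mulgA.
Qed.

Lemma quot_mul1g : left_id quot_one quot_mul.
Proof. by move=> C; case: (to_quot_ex C) => g <-; rewrite -to_quotM mul1g. Qed.

Lemma quot_mulg1 : right_id quot_one quot_mul.
Proof. by move=> C; case: (to_quot_ex C) => g <-; rewrite -to_quotM mulg1. Qed.

Lemma quot_mulVg : left_inverse quot_one quot_inv quot_mul.
Proof.
by move=> C; case: (to_quot_ex C) => g <-; rewrite -to_quotV -to_quotM mulVg.
Qed.

Lemma quot_mulgV : right_inverse quot_one quot_inv quot_mul.
Proof.
by move=> C; case: (to_quot_ex C) => g <-; rewrite -to_quotV -to_quotM mulgV.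
Qed.

HB.instance Definition _ := isGroup.Build (quot N)
  quot_mulA quot_mul1g quot_mulg1 quot_mulVg quot_mulgV.

End QuotGroup.

Section ProfiniteCompletion.
Context {Gam : groupType}.

(* For [N `<=` M] the canonical map Gam/N -> Gam/M sends a coset of N to the
   unique coset of M that contains it. *)
Definition compatible :
    set (prod_topology (fun N : fin_normal Gam => discrete_topology (quot N))) :=
  [set x | forall N M : fin_normal Gam, (N : set Gam) `<=` M ->
    (val (x N : quot N) : set Gam) `<=` val (x M : quot M)].

End ProfiniteCompletion.

Definition profinite_completion (Gam : groupType) : Type :=
  set_type (@compatible Gam).

HB.instance Definition _ (Gam : groupType) :=
  Topological.copy (profinite_completion Gam) (set_type (@compatible Gam)).


Section ProfiniteCompletionGroup.
Context {Gam : groupType}.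
Implicit Types (x y : profinite_completion Gam) (N M : fin_normal Gam).

Definition pc_proj N x : discrete_topology (quot N) := val x N.

Lemma pc_projP x N M : (N : set Gam) `<=` M ->
  exists g, pc_proj N x = to_quot N g /\ pc_proj M x = to_quot M g.
Proof.
move=> NM; have [g eg] := to_quot_ex (pc_proj N x).
exists g; split=> //; have [h eh] := to_quot_ex (pc_proj M x).
have xNg : (val (pc_proj N x : quot N) : set Gam) g.
  by rewrite -eg; apply/mem_lcoset; rewrite mulVg; case: (fin_normalP N).
have : (val (pc_proj M x : quot M) : set Gam) g := set_valP x N M NM g xNg.
by rewrite -eh => /mem_lcoset Mg; apply/to_quot_eq.
Qed.

Lemma to_quotS N M g : (N : set Gam) `<=` M ->
  (val (to_quot N g) : set Gam) `<=` val (to_quot M g).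
Proof. by move=> NM _ [n Nn <-]; exists n => //; exact: NM. Qed.

Definition pc_build (f : forall N, quot N)
    (fP : forall N M, (N : set Gam) `<=` M ->
       exists g, f N = to_quot N g /\ f M = to_quot M g) :
  profinite_completion Gam.
Proof.
apply: (@SigSub _ _ _ (f : prod_topology (fun N => discrete_topology (quot N)))).
by rewrite inE => N M NM; have [g [-> ->]] := fP N M NM; exact: to_quotS.
Defined.

Lemma pc_eq x y : (forall N, pc_proj N x = pc_proj N y) -> x = y.
Proof. by move=> e; apply/val_inj/functional_extensionality_dep. Qed.

Definition to_completion (g : Gam) : profinite_completion Gam.
Proof. by apply: (@pc_build (fun N => to_quot N g)) => N M _; exists g. Defined.

Definition pc_mul x y : profinite_completion Gam.
Proof.
apply: (@pc_build (fun N => (pc_proj N x : quot N) * pc_proj N y)) => N M NM.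
have [[g [-> ->]] [h [-> ->]]] := (pc_projP x NM, pc_projP y NM).
by exists (g * h); rewrite !to_quotM.
Defined.

Definition pc_inv x : profinite_completion Gam.
Proof.
apply: (@pc_build (fun N => (pc_proj N x : quot N)^-1)) => N M NM.
by have [g [-> ->]] := pc_projP x NM; exists g^-1; rewrite !to_quotV.
Defined.

Let pc_mulA : associative pc_mul.
Proof. by move=> x y z; apply: pc_eq => N; exact: mulgA. Qed.
Let pc_mul1g : left_id (to_completion 1) pc_mul.
Proof. by move=> x; apply: pc_eq => N; exact: mul1g. Qed.
Let pc_mulg1 : right_id (to_completion 1) pc_mul.
Proof. by move=> x; apply: pc_eq => N; exact: mulg1. Qed.
Let pc_mulVg : left_inverse (to_completion 1) pc_inv pc_mul.
Proof. by move=> x; apply: pc_eq => N; exact: mulVg. Qed.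
Let pc_mulgV : right_inverse (to_completion 1) pc_inv pc_mul.
Proof. by move=> x; apply: pc_eq => N; exact: mulgV. Qed.

HB.instance Definition _ := isGroup.Build (profinite_completion Gam)
  pc_mulA pc_mul1g pc_mulg1 pc_mulVg pc_mulgV.

Lemma to_completionM : {morph to_completion : g h / g * h}.
Proof. by move=> g h; apply: pc_eq => N; exact: to_quotM. Qed.

Lemma pc_proj_continuous N : continuous (@pc_proj N).
Proof.
pose K N := discrete_topology (@quot Gam N).
have valc : continuous (val : profinite_completion Gam -> prod_topology K).
  exact: initial_continuous.
by move=> x; exact: (continuous_comp (valc x) (@proj_continuous _ K N _)).
Qed.

Lemma continuous_to_pc (T : topologicalType) (f : T -> profinite_completion Gam) :
  (forall N, continuous (fun t => pc_proj N (f t))) -> continuous f.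
Proof.
move=> fc; apply: continuous_comp_initial => t; apply/cvg_sup => N.
move=> A [_ [[B oB <-] Bft] sBA].
apply: (@filterS _ _ _ (fun s => B (pc_proj N (f s)))); first by move=> s; exact: sBA.
by apply: fc; apply: open_nbhs_nbhs.
Qed.

Let pc_mul_continuous : continuous
  (fun xy : profinite_completion Gam * profinite_completion Gam => xy.1 * xy.2).
Proof.
apply: continuous_to_pc => N [x y] A /= Axy.
have Axy' : A (pc_proj N (x * y)) by exact: nbhs_singleton.
have nb z : nbhs z [set t | pc_proj N t = pc_proj N z].
  by apply: (@pc_proj_continuous N z [set pc_proj N z]); exact: discrete_set1.
exists ([set t | pc_proj N t = pc_proj N x], [set t | pc_proj N t = pc_proj N y]).
  by split; exact: nb.
move=> [s t] /= [es et]; rewrite -[pc_proj N _]/((pc_proj N s : quot N) * pc_proj N t).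
by rewrite es et.
Qed.

Let pc_inv_continuous : continuous (fun x : profinite_completion Gam => x^-1).
Proof.
apply: continuous_to_pc => N x A /= Ax.
have Ax' : A (pc_proj N x^-1) by exact: nbhs_singleton.
have : nbhs x [set t | pc_proj N t = pc_proj N x].
  by apply: (@pc_proj_continuous N x [set pc_proj N x]); exact: discrete_set1.
apply: filterS => t /= et; rewrite -[pc_proj N _]/((pc_proj N t : quot N)^-1).
by rewrite et.
Qed.

HB.instance Definition _ := isTopologicalGroup.Build (profinite_completion Gam)
  pc_mul_continuous pc_inv_continuous.

End ProfiniteCompletionGroup.

Record dirsys := Dirsys {
  ds_idx : choiceType;
  ds_lt : ds_idx -> ds_idx -> Prop;
  ds_ob : ds_idx -> groupType;
  ds_map : forall i j, ds_lt i j -> ds_ob i -> ds_ob j;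
  ds_mapM : forall i j (ij : ds_lt i j), {morph ds_map ij : x y / x * y};
  ds_mapC : forall i j k (ij : ds_lt i j) (jk : ds_lt j k) (ik : ds_lt i k) x,
    ds_map jk (ds_map ij x) = ds_map ik x;
  ds_ltT : forall i j k, ds_lt i j -> ds_lt j k -> ds_lt i k;
  ds_pt : ds_idx;
  ds_dir : forall i j, exists k, ds_lt i k /\ ds_lt j k }.

Section DirectLimit.
Context (D : dirsys).
Local Notation germ := {i : ds_idx D & ds_ob i}.

(* [ds_lt] being strictly directed, a common strict upper bound always exists,
   so that no identity maps are needed here. *)
Definition germ_eq (a b : germ) : Prop :=
  exists k (ak : ds_lt (tag a) k) (bk : ds_lt (tag b) k),
    ds_map ak (tagged a) = ds_map bk (tagged b).

Let germ_refl : reflexive (fun a b => `[< germ_eq a b >]).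
Proof.
move=> a; apply/asboolP; have [k [ak _]] := ds_dir (tag a) (tag a).
by exists k, ak, ak.
Qed.

Let germ_sym : symmetric (fun a b => `[< germ_eq a b >]).
Proof.
by move=> a b; apply/asboolP/asboolP => -[k [ak [bk e]]]; exists k, bk, ak.
Qed.

Let germ_trans : transitive (fun a b => `[< germ_eq a b >]).
Proof.
move=> b a c /asboolP[k [ak [bk e]]] /asboolP[l [bl [cl e']]]; apply/asboolP.
have [m [km lm]] := ds_dir k l.
exists m, (ds_ltT ak km), (ds_ltT cl lm).
rewrite -(ds_mapC ak km) -(ds_mapC cl lm) e -e'.
by rewrite (ds_mapC bk km (ds_ltT bl lm)) (ds_mapC bl lm (ds_ltT bl lm)).
Qed.

Definition germ_equiv : equiv_rel germ :=
  EquivRel _ germ_refl germ_sym germ_trans.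

Definition dirlim : Type := {eq_quot germ_equiv}.

HB.instance Definition _ := Choice.copy dirlim {eq_quot germ_equiv}.
HB.instance Definition _ := EqQuotient.copy dirlim {eq_quot germ_equiv}.

Definition to_dirlim i (x : ds_ob i) : dirlim :=
  \pi_dirlim (Tagged (@ds_ob D) x).

Lemma to_dirlim_eq i j (x : ds_ob i) (y : ds_ob j) :
  to_dirlim x = to_dirlim y <->
  germ_eq (Tagged (@ds_ob D) x) (Tagged (@ds_ob D) y).
Proof. by split=> [/eqquotP/asboolP|?]; [|apply/eqquotP/asboolP]. Qed.

Lemma to_dirlim_map i j (ij : ds_lt i j) (x : ds_ob i) :
  to_dirlim (ds_map ij x) = to_dirlim x.
Proof.
apply/to_dirlim_eq; have [k [jk _]] := ds_dir j j.
by exists k, jk, (ds_ltT ij jk); exact: ds_mapC.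
Qed.

Lemma to_dirlim_repr (u : dirlim) : to_dirlim (tagged (repr u)) = u.
Proof. by rewrite /to_dirlim taggedK reprK. Qed.

Definition dirlim_one : dirlim := to_dirlim (1 : ds_ob (ds_pt D)).

Definition dirlim_mul (u v : dirlim) : dirlim :=
  let k := cid (ds_dir (tag (repr u)) (tag (repr v))) in
  to_dirlim (ds_map (svalP k).1 (tagged (repr u))
             * ds_map (svalP k).2 (tagged (repr v))).

Definition dirlim_inv (u : dirlim) : dirlim := to_dirlim (tagged (repr u))^-1.

Let map1 i j (ij : @ds_lt D i j) : ds_map ij 1 = 1.
Proof.
have e : ds_map ij 1 * ds_map ij 1 = ds_map ij 1 by rewrite -ds_mapM mul1g.
by rewrite -[LHS]mul1g -(mulVg (ds_map ij 1)) -mulgA e.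
Qed.

Let mapV i j (ij : @ds_lt D i j) x : ds_map ij x^-1 = (ds_map ij x)^-1.
Proof.
rewrite -[LHS]mul1g -(mulVg (ds_map ij x)) -mulgA -ds_mapM mulgV map1.
by rewrite mulg1.
Qed.

Lemma to_dirlimM i (x y : ds_ob i) :
  to_dirlim (x * y) = dirlim_mul (to_dirlim x) (to_dirlim y).
Proof.
rewrite /dirlim_mul; case: cid => k kP.
have /to_dirlim_eq[l [/= al [il ex]]] := to_dirlim_repr (to_dirlim x).
have /to_dirlim_eq[m [/= bm [im ey]]] := to_dirlim_repr (to_dirlim y).
have [n [ln mn]] := ds_dir l m; have [o [ko no]] := ds_dir k n.
have [lo mo] := (ds_ltT ln no, ds_ltT mn no).
have io := ds_ltT il lo.
rewrite -(to_dirlim_map ko) -(to_dirlim_map io) !ds_mapM; congr (to_dirlim (_ * _)).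
  have ao := ds_ltT al lo.
  by rewrite (ds_mapC _ ko ao) -(ds_mapC al lo ao) ex (ds_mapC il lo io).
have bo := ds_ltT bm mo.
by rewrite (ds_mapC _ ko bo) -(ds_mapC bm mo bo) ey (ds_mapC im mo io).
Qed.

Lemma to_dirlimV i (x : ds_ob i) : to_dirlim x^-1 = dirlim_inv (to_dirlim x).
Proof.
rewrite /dirlim_inv.
have /to_dirlim_eq[l [/= al [il ex]]] := to_dirlim_repr (to_dirlim x).
by rewrite -(to_dirlim_map il) -(to_dirlim_map al) !mapV ex.
Qed.

Lemma to_dirlim1 i : to_dirlim (1 : ds_ob i) = dirlim_one.
Proof.
have [k [ik pk]] := ds_dir i (ds_pt D).
by rewrite /dirlim_one -(to_dirlim_map ik) -(to_dirlim_map pk) !map1.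
Qed.

Lemma to_dirlim_ex (u : dirlim) : exists i (x : ds_ob i), u = to_dirlim x.
Proof. by exists (tag (repr u)), (tagged (repr u)); rewrite to_dirlim_repr. Qed.

Let dirlim_mulA : associative dirlim_mul.
Proof.
move=> u v w; have [i [x ->]] := to_dirlim_ex u.
have [j [y ->]] := to_dirlim_ex v; have [k [z ->]] := to_dirlim_ex w.
have [l [il jl]] := ds_dir i j; have [m [lm km]] := ds_dir l k.
rewrite -(to_dirlim_map (ds_ltT il lm)) -(to_dirlim_map (ds_ltT jl lm)).
by rewrite -(to_dirlim_map km) -!to_dirlimM mulgA.
Qed.

Let dirlim_mul1g : left_id dirlim_one dirlim_mul.
Proof.
move=> u; have [i [x ->]] := to_dirlim_ex u.
by rewrite -(to_dirlim1 i) -to_dirlimM mul1g.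
Qed.

Let dirlim_mulg1 : right_id dirlim_one dirlim_mul.
Proof.
move=> u; have [i [x ->]] := to_dirlim_ex u.
by rewrite -(to_dirlim1 i) -to_dirlimM mulg1.
Qed.

Let dirlim_mulVg : left_inverse dirlim_one dirlim_inv dirlim_mul.
Proof.
move=> u; have [i [x ->]] := to_dirlim_ex u.
by rewrite -to_dirlimV -to_dirlimM mulVg to_dirlim1.
Qed.

Let dirlim_mulgV : right_inverse dirlim_one dirlim_inv dirlim_mul.
Proof.
move=> u; have [i [x ->]] := to_dirlim_ex u.
by rewrite -to_dirlimV -to_dirlimM mulgV to_dirlim1.
Qed.

HB.instance Definition _ := isGroup.Build dirlim
  dirlim_mulA dirlim_mul1g dirlim_mulg1 dirlim_mulVg dirlim_mulgV.

End DirectLimit.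

Definition cast (A B : topGroupType) (e : A = B) (x : A) : B :=
  let: erefl := e in x.

Lemma castE (A : topGroupType) (e : A = A) x : cast e x = x.
Proof. by rewrite (Prop_irrelevance e erefl). Qed.

Lemma castT (A B C : topGroupType) (e : A = B) (e' : B = C) (e'' : A = C) x :
  cast e' (cast e x) = cast e'' x.
Proof. by case: _ / e' e''; case: _ / e => e''; rewrite !castE. Qed.

Lemma castM (A B : topGroupType) (e : A = B) :
  {morph cast e : x y / x * y}.
Proof. by case: _ / e. Qed.

(* An element a of a well-ordered type W stands for the ordinal that is the
   order type of {b | b < a}; every ordinal arises in this way. *)
Section Tower.
Context {d : Order.disp_t} {W : orderType d}.
Implicit Types a b c : W.

(* Groups indexed by the b < a, with abstract transition homomorphisms. *)
Record system (a : W) := System {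
  sys_ob : forall b, b < a -> topGroupType;
  sys_map : forall b c (ba : b < a) (ca : c < a), b < c ->
    @sys_ob b ba -> @sys_ob c ca;
  sys_mapM : forall b c (ba : b < a) (ca : c < a) (bc : b < c),
    {morph @sys_map b c ba ca bc : x y / x * y};
  sys_mapC : forall b c e (ba : b < a) (ca : c < a) (ea : e < a)
    (bc : b < c) (ce : c < e) (be : b < e) x,
    @sys_map c e ca ea ce (@sys_map b c ba ca bc x) = @sys_map b e ba ea be x }.

Arguments sys_ob {a} s {b}.
Arguments sys_map {a} s {b c} ba ca.
Arguments sys_mapM {a} s {b c} ba ca.
Arguments sys_mapC {a} s {b c e} ba ca ea.

(* A group at stage a with compatible homomorphisms from all earlier stages. *)
Record extension (a : W) (S : system a) := Extension {
  ext_ob : topGroupType;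
  ext_map : forall b (ba : b < a), sys_ob S ba -> ext_ob;
  ext_mapM : forall b (ba : b < a), {morph @ext_map b ba : x y / x * y};
  ext_mapC : forall b c (ba : b < a) (ca : c < a) (bc : b < c) x,
    @ext_map c ca (sys_map S ba ca bc x) = @ext_map b ba x }.

Arguments ext_ob {a S} e.
Arguments ext_map {a S} e {b}.

Variant stage (a : W) : Type :=
  | Zero of (forall b, ~ b < a)
  | Successor b of b < a & (forall c, c < a -> c <= b)
  | Limit b0 of b0 < a & (forall b, b < a -> exists2 c, b < c & c < a).

Lemma stage_ex a : inhabited (stage a).
Proof.
have [[b0 b0a]|n0] := pselect (exists b, b < a); last first.
  by apply: inhabits; apply: Zero => b ba; apply: n0; exists b.
have [[b [ba bmax]]|nS] :=
  pselect (exists b, b < a /\ forall c, c < a -> c <= b).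
  exact: inhabits (Successor ba bmax).
apply: inhabits; apply: (Limit b0a) => b ba; apply: contrapT => nc.
apply: nS; exists b; split=> // c ca; rewrite leNgt; apply/negP => bc.
by apply: nc; exists c.
Qed.

(* The three cases are mutually exclusive, and b is unique in the second. *)
Definition stage_of a : stage a := inhabited_witness (stage_ex a).

Section ZeroStage.
Variables (G : topGroupType) (a : W) (S : system a).
Hypothesis a0 : forall b, ~ b < a.

Definition zero_extension : extension S.
Proof.
by exists G (fun b ba _ => False_rect _ (a0 ba)) => b; [move=> ba|move=> c ba];
  case: (a0 ba).
Defined.

End ZeroStage.

Section SuccessorStage.
Variables (a : W) (S : system a) (b : W) (ba : b < a).
Hypothesis bmax : forall c, c < a -> c <= b.

Let sys_ob_eq c (ca : c < a) : c = b -> sys_ob S ca = sys_ob S ba.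
Proof. by move=> cb; subst c; rewrite (bool_irrelevance ca ba). Qed.

Let map_to_pred_subproof c : c < a -> ~ c < b -> c = b.
Proof.
by move=> ca /negP/negPf ncb; have := bmax ca; rewrite le_eqVlt ncb orbF => /eqP.
Qed.

(* [cast] stands for the identity map of stage b in case c = b. *)
Definition map_to_pred c (ca : c < a) : sys_ob S ca -> sys_ob S ba :=
  match pselect (c < b) with
  | left cb => sys_map S ca ba cb
  | right ncb => cast (sys_ob_eq ca (map_to_pred_subproof ca ncb))
  end.

Definition succ_extension : extension S.
Proof.
exists (profinite_completion (sys_ob S ba))
  (fun c ca x => to_completion (map_to_pred x)).
- move=> c ca x y; rewrite -to_completionM; congr to_completion.
  rewrite /map_to_pred; case: (pselect (c < b)) => cb; [exact: sys_mapM|exact: castM].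
- move=> c e ca ea ce x; congr to_completion; rewrite /map_to_pred.
  case: (pselect (e < b)) => eb; case: (pselect (c < b)) => cb.
  + exact: sys_mapC.
  + by case: cb; exact: lt_trans ce eb.
  + move: (sys_ob_eq _ _); have e_b := map_to_pred_subproof ea eb; subst e.
    by rewrite (bool_irrelevance ba ea) (bool_irrelevance cb ce) => ?; rewrite castE.
  + have e_b := map_to_pred_subproof ea eb; have c_b := map_to_pred_subproof ca cb.
    by exfalso; move: (ce); rewrite [X in _ < X]e_b [X in X < _]c_b ltxx.
Defined.

End SuccessorStage.

Section LimitStage.
Variables (a : W) (S : system a) (b0 : W) (b0a : b0 < a).
Hypothesis nomax : forall b, b < a -> exists2 c, b < c & c < a.

Let idx := {b : W | b < a}.

Let limit_dir (i j : idx) : exists k : idx, sval i < sval k /\ sval j < sval k.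
Proof.
have [c ic ca] := nomax (svalP i); have [e je ea] := nomax (svalP j).
have [ce|ec] := leP c e; first by exists (exist _ e ea); rewrite (lt_le_trans ic ce).
by exists (exist _ c ca); rewrite /= ic (lt_trans je ec).
Qed.

Definition limit_dirsys : dirsys := @Dirsys idx
  (fun i j => sval i < sval j)
  (fun i => sys_ob S (proj2_sig i))
  (fun i j ij => sys_map S (proj2_sig i) (proj2_sig j) ij)
  (fun i j ij => sys_mapM S (proj2_sig i) (proj2_sig j) ij)
  (fun i j k ij jk ik => sys_mapC S (proj2_sig i) (proj2_sig j) (proj2_sig k) ij jk ik)
  (fun i j k => @lt_trans _ W (sval j) (sval i) (sval k))
  (exist _ b0 b0a)
  limit_dir.

Definition to_limit b (ba : b < a) (x : sys_ob S ba) : dirlim limit_dirsys :=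
  @to_dirlim limit_dirsys (exist _ b ba) x.

Definition limit_extension : extension S.
Proof.
exists (profinite_completion (dirlim limit_dirsys))
  (fun b ba x => to_completion (to_limit x)).
- move=> b ba x y; rewrite -to_completionM; congr to_completion.
  exact: (@to_dirlimM limit_dirsys (exist _ b ba)).
- move=> b c ba ca bc x; congr to_completion.
  exact: (@to_dirlim_map limit_dirsys (exist _ b ba) (exist _ c ca)).
Defined.

End LimitStage.

Variable G : topGroupType.

Definition step (a : W) (S : system a) : extension S :=
  match stage_of a with
  | Zero a0 => zero_extension G S a0
  | Successor b ba bmax => succ_extension S ba bmax
  | Limit b0 b0a nomax => limit_extension S b0a nomax
  end.

(* The hypothesis on initial segments is a variable, rather than an instance of
   transitivity, to make restrictions compose definitionally. *)
Definition restr a b (ab : forall c, c < b -> c < a) (S : system a) : system b :=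
  @System b (fun c cb => sys_ob S (ab c cb))
    (fun c e cb eb ce => sys_map S (ab c cb) (ab e eb) ce)
    (fun c e cb eb ce => sys_mapM S (ab c cb) (ab e eb) ce)
    (fun c e f cb eb fb ce ef cf =>
       sys_mapC S (ab c cb) (ab e eb) (ab f fb) ce ef cf).

Definition sys_ext a b (ba : b < a) (ab : forall c, c < b -> c < a)
    (S : system a) : extension (restr ab S) :=
  @Extension b (restr ab S) (sys_ob S ba)
    (fun c cb => sys_map S (ab c cb) ba cb)
    (fun c cb => sys_mapM S (ab c cb) ba cb)
    (fun c e cb eb ce => sys_mapC S (ab c cb) (ab e eb) ba ce eb cb).

(* S obeys the recursion at all stages below a. *)
Definition recursive a (S : system a) : Prop :=
  forall b (ba : b < a) (ab : forall c, c < b -> c < a),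
    sys_ext ba ab S = step (restr ab S).

Lemma system_eq a (S T : system a)
    (e : forall b (ba : b < a), sys_ob S ba = sys_ob T ba) :
  (forall b c (ba : b < a) (ca : c < a) (bc : b < c) x,
     cast (e c ca) (sys_map S ba ca bc x) = sys_map T ba ca bc (cast (e b ba) x)) ->
  S = T.
Proof.
case: S T e => [So Sm SM SC] [To Tm TM TC] /= e em.
have eo : So = To.
  by apply: functional_extensionality_dep => b; apply: functional_extensionality_dep.
case: _ / eo Tm TM TC e em => Tm TM TC e em.
have eqm : Sm = Tm.
  do 5! [apply: functional_extensionality_dep => ?].
  by apply: funext => x; rewrite -[LHS](castE (e _ _)) em castE.
case: _ / eqm TM TC em => TM TC _.
by rewrite (Prop_irrelevance SM TM) (Prop_irrelevance SC TC).
Qed.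

Lemma extension_eq a (S T : system a) (E : extension S) (F : extension T)
    (e : forall b (ba : b < a), sys_ob S ba = sys_ob T ba)
    (eo : ext_ob E = ext_ob F) :
  S = T ->
  (forall b (ba : b < a) x, cast eo (ext_map E ba x) = ext_map F ba (cast (e b ba) x)) ->
  existT (@extension a) S E = existT (@extension a) T F.
Proof.
move=> ST; case: _ / ST F e eo => F e eo em; congr existT.
case: E F eo em => [Eo Em EM EC] [Fo Fm FM FC] /= eo.
case: _ / eo Fm FM FC => Fm FM FC em.
have eqm : Em = Fm.
  do 2! [apply: functional_extensionality_dep => ?].
  by apply: funext => x; rewrite -[LHS](castE erefl) em castE.
case: _ / eqm FM FC em => FM FC _.
by rewrite (Prop_irrelevance EM FM) (Prop_irrelevance EC FC).
Qed.

Lemma extension_eq_ob a (p q : {S : system a & extension S}) :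
  p = q -> ext_ob (projT2 p) = ext_ob (projT2 q).
Proof. by move->. Qed.

Lemma extension_eq_sys a (p q : {S : system a & extension S}) b (ba : b < a) :
  p = q -> sys_ob (projT1 p) ba = sys_ob (projT1 q) ba.
Proof. by move->. Qed.

Lemma extension_eq_map a (p q : {S : system a & extension S}) (pq : p = q)
    (eo : ext_ob (projT2 p) = ext_ob (projT2 q)) b (ba : b < a)
    (e : sys_ob (projT1 p) ba = sys_ob (projT1 q) ba) x :
  cast eo (ext_map (projT2 p) ba x) = ext_map (projT2 q) ba (cast e x).
Proof. by case: _ / pq eo e => eo e; rewrite !castE. Qed.

Let step_pair a (S : system a) : {S : system a & extension S} := existT _ S (step S).

Let sys_pair a b (ba : b < a) ab (S : system a) : {S : system b & extension S} :=
  existT _ _ (sys_ext ba ab S).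

Lemma step_pairP a (p : {S : system a & extension S}) S :
  p = step_pair S -> projT2 p = step (projT1 p).
Proof. by move->. Qed.

Lemma recursive_restr a b (ab : forall c, c < b -> c < a) (S : system a) :
  recursive S -> recursive (restr ab S).
Proof.
by move=> rS c cb bc; exact: (rS c (ab c cb) (fun e ec => ab e (bc e ec))).
Qed.

Hypothesis wo : well_order (<=%O : rel W).

Let wf : well_founded (fun a b : W => a < b).
Proof.
move=> a; apply: contrapT => na.
have [|b [[]]] := wo (A := [pred x | ~~ `[< Acc (fun a b : W => a < b) x >]]).
  by exists a; rewrite inE; apply/asboolPn.
rewrite inE => /asboolPn nb lb _; apply: nb; apply: Acc_intro => c cb.
apply: contrapT => nc; have : b <= c by apply: lb; rewrite inE; apply/asboolPn.
by rewrite leNgt cb.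
Qed.

Lemma recursive_uniq a (S T : system a) : recursive S -> recursive T -> S = T.
Proof.
elim/(well_founded_ind wf): a S T => a IH S T rS rT.
have ab b (ba : b < a) c (cb : c < b) : c < a := lt_trans cb ba.
have pe b (ba : b < a) : sys_pair ba (ab b ba) S = sys_pair ba (ab b ba) T.
  rewrite /sys_pair rS rT -!/(step_pair _); congr step_pair.
  by apply: IH => //; exact: recursive_restr.
have eo b (ba : b < a) : sys_ob S ba = sys_ob T ba := extension_eq_ob (pe b ba).
apply: (system_eq (e := eo)) => b c ba ca bc x.
rewrite -(bool_irrelevance (ab c ca b bc) ba) in x *.
exact: (extension_eq_map (pe c ca) (eo c ca) (eo _ _)).
Qed.

Lemma recursive_ex a : exists S : system a, recursive S.
Proof.
elim/(well_founded_ind wf): a => a IH.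
pose T b (ba : b < a) := sval (cid (IH b ba)).
have rT b (ba : b < a) : recursive (T b ba) := svalP (cid (IH b ba)).
pose E b (ba : b < a) := step (T b ba).
have pe b c (ba : b < a) (ca : c < a) (bc : b < c) (cb : forall e, e < b -> e < c) :
    sys_pair bc cb (T c ca) = step_pair (T b ba).
  rewrite /sys_pair rT -/(step_pair _); congr step_pair.
  by apply: recursive_uniq => //; exact: recursive_restr.
have tr b c (bc : b < c) e (eb : e < b) : e < c := lt_trans eb bc.
have eo b c (ba : b < a) (ca : c < a) (bc : b < c) :
    ext_ob (E b ba) = sys_ob (T c ca) bc :=
  esym (extension_eq_ob (pe b c ba ca bc (tr b c bc))).
have em b c e (ba : b < a) (ca : c < a) (ea : e < a) (bc : b < c) (be : b < e)
    (ce : c < e) x :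
  cast (eo c e ca ea ce) (ext_map (E c ca) bc (cast (eo b c ba ca bc) x)) =
  sys_map (T e ea) be ce bc (cast (eo b e ba ea be) x).
  rewrite -(bool_irrelevance (tr c e ce b bc) be).
  rewrite (extension_eq_map (esym (pe c e ca ea ce (tr c e ce))) (eo c e ca ea ce)
    (esym (extension_eq_sys _ (pe c e ca ea ce (tr c e ce))))) /=.
  by rewrite (castT _ _ (eo b e ba ea _)).
pose S := @System a (fun b ba => ext_ob (E b ba))
  (fun b c ba ca bc x => ext_map (E c ca) bc (cast (eo b c ba ca bc) x)).
have SM b c ba ca bc : {morph (fun x => ext_map (E c ca) bc (cast (eo b c ba ca bc) x))
    : x y / x * y}.
  by move=> x y; rewrite castM; exact: ext_mapM.
have SC b c e (ba : b < a) (ca : c < a) (ea : e < a) (bc : b < c) (ce : c < e)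
    (be : b < e) x :
  ext_map (E e ea) ce (cast (eo c e ca ea ce) (ext_map (E c ca) bc (cast (eo b c ba ca bc) x)))
  = ext_map (E e ea) be (cast (eo b e ba ea be) x).
  by rewrite (em b c e ba ca ea bc be ce); exact: ext_mapC.
exists (S SM SC) => b ba ab.
have eT : restr ab (S SM SC) = T b ba.
  apply: (@system_eq _ (restr ab (S SM SC)) (T b ba)
    (fun c cb => eo c b (ab c cb) ba cb)) => c e cb eb ce x.
  exact: em.
apply: (@step_pairP _ (sys_pair ba ab (S SM SC)) (T b ba)).
exact: (@extension_eq _ _ _ (sys_ext ba ab (S SM SC)) (E b ba)
  (fun c cb => eo c b (ab c cb) ba cb) erefl).
Qed.

Definition completion_system a : system a := sval (cid (recursive_ex a)).

(* G_a is obtained from the unique system (G_b)_(b < a) obeying the recursion. *)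
Definition completion_of_order a : topGroupType := ext_ob (step (completion_system a)).

Lemma completion_systemP a : recursive (completion_system a).
Proof. exact: (svalP (cid (recursive_ex a))). Qed.

Lemma restr_completion_system a b (ab : forall c, c < b -> c < a) :
  restr ab (completion_system a) = completion_system b.
Proof.
by apply: recursive_uniq; [apply: recursive_restr|]; exact: completion_systemP.
Qed.

Lemma sys_ob_completion_system a b (ba : b < a) :
  sys_ob (completion_system a) ba = completion_of_order b.
Proof.
pose ab c (cb : c < b) : c < a := lt_trans cb ba.
rewrite /completion_of_order -(restr_completion_system ab).
by rewrite -(completion_systemP ba ab).
Qed.

Lemma completion_of_order0 a : (forall b, ~ b < a) -> completion_of_order a = G.
Proof.
move=> a0; rewrite /completion_of_order /step; case: (stage_of a) => //.
  by move=> b ba; have := a0 b ba.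
by move=> b ba; have := a0 b ba.
Qed.

Lemma completion_of_orderS a b : b < a -> (forall c, c < a -> c <= b) ->
  completion_of_order a = profinite_completion (completion_of_order b).
Proof.
move=> ba bmax; rewrite [LHS]/completion_of_order /step; case: (stage_of a).
- by move=> a0; have := a0 b ba.
- move=> c ca cmax /=; rewrite sys_ob_completion_system.
  by have -> : c = b by apply/eqP; rewrite eq_le bmax// cmax.
- by move=> c ca nomax; have [e be /bmax] := nomax b ba; rewrite leNgt be.
Qed.

Lemma completion_of_order_lim a
    (nomax : forall b, b < a -> exists2 c, b < c & c < a) :
  (exists b, b < a) ->
  exists b0 (b0a : b0 < a), completion_of_order a =
    profinite_completion (dirlim (limit_dirsys (completion_system a) b0a nomax)).
Proof.
move=> [b ba]; rewrite /completion_of_order /step; case: (stage_of a).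
- by move=> a0; have := a0 b ba.
- by move=> c ca cmax; have [e ce /cmax] := nomax c ca; rewrite leNgt ce.
- by move=> b0 b0a nomax'; exists b0, b0a; rewrite (Prop_irrelevance nomax nomax').
Qed.

End Tower.

(* Main.v *)
From HB Require Import structures.
Require Import Defs.
From mathcomp Require Import all_boot all_order all_fingroup all_algebra all_solvable generic_quotient.
From mathcomp Require Import all_classical wochoice topology.

(* Let Gam be an abstract group such that finite embedding problems Gam -> B <- A
   with A ->> B a surjection of finite p-groups are solvable, and every element of
   Gam is a q-th power for each prime q != p.  Then the profinite completion of Gam
   is a projective pro-p group, hence free pro-p.  Both properties pass to direct
   limits, so it suffices that they hold for a free pro-p group F taken as an
   abstract group.  Let phi : F -> B be an abstract homomorphism.  On the closed
   subgroup S generated by finitely many elements of F, phi is continuous (Serre),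
   and S is projective because F is (Kaloujnine-Krasner), so phi lifts on S; by
   compactness of the space of maps F -> A, phi lifts on F. *)

Set Implicit Arguments.
Unset Strict Implicit.
Unset Printing Implicit Defensive.

Local Open Scope group_scope.

(** * Finite p-groups *)

(** The maps of the tower are homomorphisms of abstract groups, so the property carried through it
    can mention no topology; embedding problems and roots are such properties, and the topology
    reappears only on each completion. On F itself an abstract phi need not be continuous, which is
    why it is restricted to S; but a homomorphism continuous on S need not extend continuously to F,
    so a lift over S cannot be read off the projectivity of F directly. Coinduction turns the
    problem for the image of S in a finite quotient of F into one for F. Serre's argument rests on a
    bound: in a nilpotent group with n generators, products of one commutator per generator already
    exhaust the derived subgroup, so the corresponding set in S is a continuous image of S^n and
    hence closed. In passing from projective to free, characters P -> F_p replace coordinates: a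
    maximal family with dual elements yields the candidate basis. Dual elements are not unique and
    an arbitrary choice need not converge to 1, so they are chosen greedily along a well-ordering of
    the open normal subgroups. *)

Lemma pgroup_of_roots (p : nat) (A : finGroupType) :
  (forall q, prime q -> q != p -> forall x : A, exists y, y ^+ q = x) ->
  p.-group [set: A].
Proof.
move=> rootA; apply/pgroupP => q pr_q qA; apply/contraT => qp.
have [g gP] := choice (rootA q pr_q qp).
have [x _ ox] := Cauchy pr_q qA.
(* On a finite set a right inverse of the q-th power map is also a left inverse, so this map is
   injective and kills no element of order q. *)
have fK := canF_sym (gP : cancel g (fun y => y ^+ q)).
have x1 : x = 1 by rewrite -(fK x) -[LHS]/(g (x ^+ q)) -ox expg_order -{1}(expg1n A q) fK.
by move: ox pr_q; rewrite x1 order1 => <-.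
Qed.

(** * Products of p-th powers and commutators in nilpotent groups *)

Section CommutatorProducts.
Variable T : groupType.
Implicit Types (S : T -> Prop) (s : seq T).

(** One commutator per entry of [s], in the order of [s]: for compact [S] in a topological group,
    the set is a continuous image of a power of [S], hence compact. *)
Fixpoint comm_product S s : T -> Prop :=
  if s is g :: s' then fun z =>
    exists x y, [/\ S x, comm_product S s' y & z = [~ x, g] * y]
  else fun z => z = 1.

(** Exponents below p, one factor per entry: when [s] generates, a finite list of representatives
    modulo p-th powers and commutators. *)
Fixpoint small_products (p : nat) s : seq T :=
  if s is g :: s' then
    [seq g ^+ a * h | a <- iota 0 p, h <- small_products p s']
  else [:: 1].

Lemma comm_product1 S s : S 1 -> comm_product S s 1.
Proof.
by move=> S1; elim: s => //= g s IH; exists 1, 1; rewrite comm1g mul1g.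
Qed.

Lemma comm_product_mem S s g x : S 1 -> S x -> g \in s -> comm_product S s [~ x, g].
Proof.
move=> S1 Sx; elim: s => //= h s IH; rewrite inE => /predU1P[<-|/IH ?].
  by exists x, 1; rewrite mulg1; split=> //; exact: comm_product1.
by exists 1, [~ x, g]; rewrite comm1g mul1g.
Qed.

Lemma comm_product_in S s z :
  S 1 -> (forall x y, S x -> S y -> S (x * y)) -> (forall x, S x -> S x^-1) ->
  (forall g, g \in s -> S g) -> comm_product S s z -> S z.
Proof.
move=> S1 SM SV; elim: s z => [|g s IH] z Ss /=; first by move->.
move=> [x [y [Sx cy ->]]]; have Sg : S g by apply: Ss; rewrite mem_head.
apply: (SM); last by apply: IH => // h hs; apply: Ss; rewrite inE hs orbT.
by rewrite commgEl conjgE; do ![apply: (SM) | apply: (SV) | done].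
Qed.

(* [~ u * x, g] = [~ u, g] ^ x * [~ x, g], and the first factor is fixed by x. *)
Lemma comm_productM (K S : T -> Prop) s c d :
  (forall u x, K u -> S x -> S (u * x)) ->
  (forall u g x, K u -> g \in s -> S x -> [~ u, g] ^ x = [~ u, g]) ->
  S 1 -> (forall x y, S x -> S y -> S (x * y)) -> (forall x, S x -> S x^-1) ->
  (forall g, g \in s -> S g) ->
  comm_product S s c -> comm_product K s d -> comm_product S s (c * d).
Proof.
move=> KS cK S1 SM SV; elim: s cK c d => [|g s IH] cK c d Ss /=.
  by move=> -> ->; rewrite mulg1.
move=> [x [y [Sx cy ->]]] [u [v [Ku cv ->]]].
have gs : g \in g :: s by rewrite mem_head.
have Ss' h : h \in s -> S h by move=> hs; apply: Ss; rewrite inE hs orbT.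
exists (u * x), (y * v); split; first exact: KS.
  by apply: IH => // u' h x' Ku' hs; apply: cK; rewrite // inE hs orbT.
have -> : [~ u * x, g] = [~ u, g] ^ x * [~ x, g].
  by rewrite !commgEl !conjgE !invgM !mulgA !(mulgK, mulgVK).
have Sz : S ([~ x, g] * y).
  have Sg := Ss g gs; apply: (SM); last exact: comm_product_in cy.
  by rewrite commgEl conjgE; do ![apply: (SM) | apply: (SV) | done].
rewrite (cK _ _ _ Ku gs Sx) !mulgA -[RHS]mulgA -[[~ u, g] * _ * _ in RHS]mulgA.
have := cK _ _ _ Ku gs Sz; rewrite conjgE => /(canRL (mulVKg _)).
by rewrite !mulgA => ->.
Qed.

End CommutatorProducts.


Section CommutatorProductsLift.
Variables (T U : groupType) (f : T -> U) (S : T -> Prop).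
Hypotheses (S1 : S 1) (SM : forall x y, S x -> S y -> S (x * y))
  (SV : forall x, S x -> S x^-1)
  (fM : forall x y, S x -> S y -> f (x * y) = f x * f y).

(** Multiplicativity is assumed on [S] only, so as to cover the quotient map [coset N], a morphism
    just on the normaliser of N. *)
Lemma partial_morph1 : f 1 = 1.
Proof. by apply: (@mulgI _ (f 1)); rewrite -fM // !mulg1. Qed.

Lemma partial_morphV x : S x -> f x^-1 = (f x)^-1.
Proof.
move=> Sx; apply: (@mulgI _ (f x)); rewrite -fM //; last exact: SV.
by rewrite !mulgV partial_morph1.
Qed.

Lemma partial_morphX x n : S x -> S (x ^+ n) /\ f (x ^+ n) = f x ^+ n.
Proof.
move=> Sx; elim: n => [|n [IH1 IH2]]; first by rewrite !expg0 partial_morph1.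
by rewrite !expgS fM // IH2; split=> //; exact: SM.
Qed.

Lemma partial_morphR x y : S x -> S y -> S [~ x, y] /\ f [~ x, y] = [~ f x, f y].
Proof.
move=> Sx Sy; rewrite !commgEl !conjgE.
have [SVx SVy] := (SV Sx, SV Sy); have Sxy := SM Sx Sy; have Sy' := SM SVy Sxy.
by rewrite !fM // !partial_morphV //; split=> //; exact: SM.
Qed.

Lemma comm_product_lift (SU : U -> Prop) (s : seq T) z :
  (forall g, g \in s -> S g) -> (forall u, SU u -> exists2 x, S x & f x = u) ->
  comm_product SU (map f s) z -> exists w, [/\ comm_product S s w, S w & f w = z].
Proof.
move=> + SUP; elim: s z => /= [|g s IH] z Ss.
  by move=> ->; exists 1; split=> //; exact: partial_morph1.
move=> [_ [y [/SUP[x Sx <-] cy ->]]].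
have [h hs|w [cw Sw fw]] := IH y _ cy; first by apply: Ss; rewrite inE hs orbT.
have [SR fR] := partial_morphR Sx (Ss g (mem_head _ _)).
exists ([~ x, g] * w); rewrite fM // fR fw; split=> //; last exact: SM.
by exists x, w.
Qed.

Lemma small_products_lift p (s : seq T) z :
  (forall g, g \in s -> S g) ->
  z \in small_products p (map f s) ->
  exists w, [/\ w \in small_products p s, S w & f w = z].
Proof.
elim: s z => /= [|g s IH] z Ss.
  by rewrite inE => /eqP ->; exists 1; rewrite mem_head partial_morph1.
move=> /allpairsP[[a h] /= [ap hs ->]].
have [k ks|w [ws Sw fw]] := IH h _ hs; first by apply: Ss; rewrite inE ks orbT.
have [SX fX] := partial_morphX a (Ss g (mem_head _ _)).
exists (g ^+ a * w); rewrite fM // fX fw; split=> //; last exact: SM.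
by apply/allpairsP; exists (a, w).
Qed.

End CommutatorProductsLift.

Section FiniteCommutatorProducts.
Variable gT : finGroupType.
Implicit Types (G K : {group gT}) (s : seq gT).

(** As [K, G] is central, [x, g] is multiplicative in x and in g. Hence the products of one
    commutator per generator form a subgroup, and the g whose commutators with K all lie in it form
    a subgroup containing the generators. *)
Lemma central_commutators G K s :
  K \subset G -> G :=: <<[set x in s]>> -> [~: [~: K, G], G] = 1 ->
  forall z, z \in [~: K, G] -> comm_product (fun x => x \in K) s z.
Proof.
move=> KG defG cNG z zN.
have sG g : g \in s -> g \in G by move=> gs; rewrite defG mem_gen // inE.
have cR u g x : u \in K -> g \in G -> x \in G -> [~ u, g] ^ x = [~ u, g].
  move=> uK gG xG; apply/conjg_fixP/eqP; move/commG1P/centsP: cNG => c.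
  by apply/eqP/commgP; apply: c => //; exact: mem_commg.
have cM c d : comm_product (fun x => x \in K) s c ->
    comm_product (fun x => x \in K) s d -> comm_product (fun x => x \in K) s (c * d).
  elim: s {defG} sG c d => [|g s IH] sG c d /=; first by move=> -> ->; rewrite mulg1.
  move=> [x [y [Kx cy ->]]] [u [v [Ku cv ->]]].
  have gG : g \in G by apply: sG; rewrite mem_head.
  have sG' h : h \in s -> h \in G by move=> hs; apply: sG; rewrite inE hs orbT.
  have yG : y \in G.
    apply: (@comm_product_in _ (fun x => x \in G) s) => // *; rewrite ?groupM ?groupV //.
    elim: (s) y cy {IH sG sG'} => //= h t IHt y' [a [b [Ka cb ->]]].
    by exists a, b; rewrite (fintype.subsetP KG) //; split=> //; exact: IHt.
  exists (x * u), (y * v); split; [exact: groupM|exact: IH|].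
  rewrite (commgEl (x * u)) conjMg invgM.
  have -> : u^-1 * x^-1 * (x ^ g * u ^ g) = [~ x, g] ^ u * [~ u, g].
    by rewrite !commgEl !conjgE !mulgA !(mulgK, mulgVK).
  rewrite (cR _ _ _ Kx gG (fintype.subsetP KG _ Ku)).
  have := conjgC [~ u, g] y; rewrite (cR _ _ _ Ku gG yG).
  by move: [~ x, g] [~ u, g] => a b cb; rewrite -!mulgA; congr (_ * _); rewrite !mulgA cb.
pose D := [set z | `[< comm_product (fun x => x \in K) s z >]].
have gD : group_set D.
  apply/group_setP; split=> [|c d].
    by rewrite finset.in_set; apply/asboolP; exact: comm_product1.
  by rewrite !finset.in_set => /asboolP cc /asboolP cd; apply/asboolP; exact: cM.
suff : [~: K, G] \subset Group gD
  by move/fintype.subsetP/(_ z zN); rewrite finset.in_set => /asboolP.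
rewrite gen_subG; apply/fintype.subsetP => _ /imset2P[u g uK gG ->].
pose E := [set g in G | [forall u in K, [~ u, g] \in D]].
have gE : group_set E.
  apply/group_setP; split=> [|a b].
    by rewrite inE group1; apply/forall_inP => v vK; rewrite commg1 (group1 (Group gD)).
  rewrite !inE => /andP[aG /forall_inP aD] /andP[bG /forall_inP bD]; rewrite groupM //=.
  apply/forall_inP => v vK.
  have -> : [~ v, a * b] = [~ v, b] * [~ v, a] ^ b.
    by rewrite !commgEl !conjgE !invgM !mulgA !(mulgK, mulgVK).
  by rewrite cR // (@groupM _ (Group gD)) ?aD ?bD.
have /fintype.subsetP/(_ g) : G \subset Group gE.
  rewrite {1}defG gen_subG; apply/fintype.subsetP => a; rewrite inE => as_.
  rewrite inE sG //=; apply/forall_inP => v vK; rewrite finset.in_set; apply/asboolP.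
  exact: (@comm_product_mem _ (fun x => x \in K)).
by move=> /(_ gG); rewrite inE => /andP[_ /forall_inP]; apply.
Qed.

End FiniteCommutatorProducts.

Lemma quotient_gen_seq (gT : finGroupType) (G N : {group gT}) (s : seq gT) :
  N <| G -> G :=: <<[set x in s]>> -> <<[set x in map (coset N) s]>> = G / N.
Proof.
move=> nNG defG; have sN : [set x in s] \subset 'N(N).
  by apply: fintype.subset_trans (normal_norm nNG); rewrite defG subset_gen.
rewrite quotientE defG morphim_gen //; congr <<_>>; rewrite morphimEsub //.
apply/setP => y; rewrite inE; apply/mapP/imsetP => -[x xs ->]; exists x => //.
  by rewrite inE.
by move: xs; rewrite inE.
Qed.

(** Induction on the order of G, dividing by the last nontrivial term N = [K, G] of the lower
    central series. The product found in G / N lifts to w; the defect lies in N, where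
    [central_commutators] applies, and [comm_productM] absorbs it into w. *)
Lemma der1_comm_product (gT : finGroupType) (G : {group gT}) (s : seq gT) :
  nilpotent G -> G :=: <<[set x in s]>> ->
  forall z, z \in G^`(1) -> comm_product (fun x => x \in G) s z.
Proof.
have [m] := ubnP #|G|; elim: m gT G s => // m IH gT G s Gm nilG defG z zG'.
have sG g : g \in s -> g \in G by move=> gs; rewrite defG mem_gen // inE.
have /lcnP[n Ln] := nilG; elim: n Ln => [|n IHn] Ln.
  have G1 : G :=: 1 := Ln.
  have : z \in [1 gT] by rewrite -G1 (fintype.subsetP (der_sub 1 G)).
  by rewrite inE => /eqP ->; apply: comm_product1.
have [/IHn //|/eqP Nn1] := eqVneq ('L_n.+1(G) : {set gT}) 1%g.
have [n0|n_gt0] := posnP n.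
  have : z \in [1 gT] by move: zG'; rewrite -Ln n0.
  by rewrite inE => /eqP ->; apply: comm_product1.
pose K := ('L_n(G))%G; pose N := ('L_n.+1(G))%G.
have defN : N :=: [~: K, G] by rewrite /N /= -(prednK n_gt0) lcnSn.
have KG : K \subset G by rewrite /= lcn_sub.
have nNG : N <| G by rewrite lcn_normal.
have cNG : [~: N, G] = 1 by rewrite -lcnSn.
have cRG u g x : u \in K -> g \in G -> x \in G -> [~ u, g] ^ x = [~ u, g].
  move=> uK gG xG; apply/conjg_fixP/eqP; move/commG1P/centsP: cNG => c.
  by apply/eqP/commgP; apply: c => //; rewrite defN; exact: mem_commg.
have ltGN : #|(G / N)%G| < m.
  apply: leq_trans (ltnSE Gm); rewrite ltn_quotient //; last exact: normal_sub.
  by apply/eqP.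
have defGN : (G / N)%G :=: <<[set x in map (coset N) s]>> by rewrite (quotient_gen_seq nNG).
have zGN' : coset N z \in (G / N)^`(1).
  rewrite -quotient_der ?normal_norm // mem_quotient //.
have nNx x : x \in G -> x \in 'N(N) := fintype.subsetP (normal_norm nNG) x.
have cz := IH _ _ _ ltGN (quotient_nil N nilG) defGN _ zGN'.
have [||||u|w [cw wG /eqP]] :=
  comm_product_lift (S := fun x => x \in G) (f := coset N) _ _ _ _ sG _ cz.
- exact: group1.
- by move=> x y; exact: groupM.
- by move=> x; exact: groupVr.
- by move=> x y xG yG; rewrite morphM ?nNx.
- by move=> /morphimP[x _ xG ->]; exists x.
rewrite eq_sym => /eqP ezw.
have zG := fintype.subsetP (der_sub 1 G) z zG'.
have /rcoset_kercosetP : coset N z = coset N w by [].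
move=> /(_ (nNx z zG) (nNx w wG)) /rcosetP[y yN ezyw].
have cy : comm_product (fun x => x \in K) s y.
  by apply: (@central_commutators _ G) => //; rewrite -defN.
have -> : z = w * y.
  by rewrite ezyw; move/commG1P/centsP: cNG => c; exact: c.
apply: (@comm_productM _ (fun x => x \in K)) cy => //.
- by move=> u x uK xG; rewrite groupM // (fintype.subsetP KG).
- by move=> u g x uK gs xG; apply: cRG => //; exact: sG.
- by move=> x y'; exact: groupM.
- by move=> x; exact: groupVr.
Qed.

(** Euclidean division by p of the exponent of each generator. *)
Lemma abelian_small_product (p : nat) (gT : finGroupType) (s : seq gT) :
  0 < p -> abelian <<[set x in s]>> ->
  forall z, z \in <<[set x in s]>> ->
  exists h y, [/\ h \in small_products p s, y \in <<[set x in s]>> & z = h * y ^+ p].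
Proof.
move=> p0; elim: s => [|g s IH] ab z zs.
  exists 1, 1; rewrite group1 mem_head expg1n mulg1; split=> //.
  move: zs; have -> : [set x in [::]] = finset.set0 :> {set gT} by apply/setP => x; rewrite !inE.
  by rewrite gen0 inE => /eqP.
have sub : [set x in s] \subset [set x in g :: s].
  by apply/fintype.subsetP => x; rewrite !inE => ->; rewrite orbT.
have ab' : abelian <<[set x in s]>> by apply: abelianS ab; exact: genS.
have defs : <<[set x in g :: s]>> = <[g]> * <<[set x in s]>>.
  have -> : [set x in g :: s] = [set g] :|: [set x in s].
    by apply/setP => x; rewrite !inE.
  rewrite -joingE -joing_idl -joing_idr comm_joingE //; apply: centC.
  apply: sub_abelian_cent2 ab _ _; rewrite ?genS //.
  by rewrite finset.sub1set inE mem_head.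
move: zs; rewrite {1}defs => /mulsgP[_ w /cycleP[a ->] /(IH ab')[h [y [hs ys ->]]] ->].
have gs : g \in <<[set x in g :: s]>> by rewrite mem_gen // inE mem_head.
have ys' : y \in <<[set x in g :: s]>> by apply: fintype.subsetP ys; exact: genS.
have cgy : commute g y by apply: (centsP ab).
have hs' : h \in <<[set x in g :: s]>>.
  have sG k : k \in s -> k \in <<[set x in g :: s]>>.
    by move=> ks; rewrite mem_gen // inE in_cons ks orbT.
  rewrite -(map_id s) in hs.
  have [|||h' [_ hG' /= <- //]] := small_products_lift (f := id) _ _ _ sG hs.
  - exact: group1.
  - by move=> x x'; exact: groupM.
  - by [].
exists (g ^+ (a %% p) * h), (g ^+ (a %/ p) * y); split.
- by apply/allpairsP; exists (a %% p, h); rewrite mem_iota /= ltn_mod p0.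
- by rewrite groupM // groupX.
have chg : commute h (g ^+ (a %/ p * p)) by apply: (centsP ab); rewrite ?groupX.
rewrite expgMn; last exact/commute_sym/commuteX/commute_sym.
rewrite -expgM {1}(divn_eq a p) addnC expgD -!mulgA; congr (_ * _).
by rewrite !mulgA chg.
Qed.

(* Mod [G, G] this is the abelian case; elements of [G, G] are products of one
   commutator per generator. *)
Lemma nilpotent_product (p : nat) (gT : finGroupType) (G : {group gT}) (s : seq gT) :
  0 < p -> nilpotent G -> G :=: <<[set x in s]>> -> forall z, z \in G ->
  exists h y c, [/\ h \in small_products p s, h \in G, y \in G,
    comm_product (fun x => x \in G) s c & z = h * y ^+ p * c].
Proof.
move=> p0 nilG defG z zG; pose N := (G^`(1))%G.
have sG g : g \in s -> g \in G by move=> gs; rewrite defG mem_gen // inE.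
have nNG : N <| G by exact: der_normal.
have nNx x : x \in G -> x \in 'N(N) := fintype.subsetP (normal_norm nNG) x.
have defGN := quotient_gen_seq nNG defG.
have abGN : abelian <<[set x in map (coset N) s]>> by rewrite defGN der_abelian.
have zN : coset N z \in <<[set x in map (coset N) s]>> by rewrite defGN mem_quotient.
have [h' [y' [hs]]] := abelian_small_product p0 abGN zN.
rewrite defGN => /morphimP[y _ yG ->] ez.
have [|||h [hsm hG eh]] := small_products_lift (S := fun x => x \in G) (f := coset N) _ _ _ sG hs.
- exact: group1.
- by move=> x x'; exact: groupM.
- by move=> x x' xG xG'; rewrite morphM ?nNx.
have hyG : h * y ^+ p \in G by rewrite groupM ?groupX.
exists h, y, ((h * y ^+ p)^-1 * z); split=> //; last by rewrite mulKVg.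
apply: der1_comm_product => //.
have e1 : coset N (h * y ^+ p) = coset N z.
  rewrite morphM; [|exact: nNx|exact/nNx/groupX].
  by rewrite morphX ?nNx //= eh ez.
have : coset N ((h * y ^+ p)^-1 * z) = 1.
  rewrite morphM; [|exact/nNx/groupVr|exact: nNx].
  rewrite morphV; [|exact: nNx].
  by move: e1 => /= ->; rewrite mulVg.
by move/coset_idr; apply; rewrite nNx // groupM ?groupV.
Qed.

Lemma pgroup_power_comm (p : nat) (gT : finGroupType) (D : {group gT}) :
  p.-group D -> D :!=: 1 -> exists K : {group gT},
  [/\ K \proper D, forall x, x \in D -> x ^+ p \in K
    & forall x y, x \in D -> y \in D -> [~ x, y] \in K].
Proof.
move=> pD D1; exists 'Phi(D)%G; rewrite Phi_proper //= (Phi_joing pD).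
split=> // [x xD|x y xD yD]; apply: mem_gen; rewrite inE.
  by rewrite (@Mho_p_elt 1) ?orbT //; exact: mem_p_elt xD.
by rewrite derg1 mem_commg.
Qed.

Lemma pgroup_central_elt (p : nat) (A : finGroupType) :
  p.-group [set: A] -> 1 < #|A| -> exists z : A, #[z] = p /\ forall x, commute x z.
Proof.
move=> pA A1; have pr : prime p.
  have [] := pgroup_pdiv pA; last by move=> pr.
  by rewrite -cardG_gt1 cardsT.
have Z1 : 'Z([set: A]) != 1.
  by rewrite center_nil_eq1 ?(pgroup_nil pA) // -cardG_gt1 cardsT.
have pZ : p.-group 'Z([set: A]) by apply: pgroupS pA; exact: finset.subsetT.
have [_ pd _] := pgroup_pdiv pZ Z1.
have [z zZ oz] := Cauchy pr pd; exists z; split=> // x.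
by have /centerP[_] := zZ => /(_ x (finset.in_setT x)) /commute_sym.
Qed.

(** * Wreath products *)

(* The wreath product of A by Q, for the action of Q on the subsets of Q by
   right translation; only the cosets of a subgroup of Q will matter. *)
Definition wreath (Q A : finGroupType) : Type := (Q * {ffun {set Q} -> A})%type.

Section Wreath.
Variables Q A : finGroupType.

HB.instance Definition _ := Finite.copy (wreath Q A) (Q * {ffun {set Q} -> A})%type.

Definition wreath_mul (x y : wreath Q A) : wreath Q A :=
  (x.1 * y.1, [ffun Y => x.2 Y * y.2 (Y :* x.1)]).
Definition wreath_one : wreath Q A := (1, [ffun=> 1]).
Definition wreath_inv (x : wreath Q A) : wreath Q A :=
  (x.1^-1, [ffun Y => (x.2 (Y :* x.1^-1))^-1]).

Lemma wreath_mulA : associative wreath_mul.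
Proof.
move=> x y z; rewrite /wreath_mul /= mulgA; congr pair.
by apply/ffunP => Y; rewrite !ffunE mulgA rcosetM.
Qed.

Lemma wreath_mul1g : left_id wreath_one wreath_mul.
Proof.
move=> [q f]; rewrite /wreath_mul /= mul1g; congr pair.
by apply/ffunP => Y; rewrite !ffunE mul1g rcoset1.
Qed.

Lemma wreath_mulVg : left_inverse wreath_one wreath_inv wreath_mul.
Proof.
move=> [q f]; rewrite /wreath_mul /wreath_inv /= mulVg; congr pair.
by apply/ffunP => Y; rewrite !ffunE mulVg.
Qed.

HB.instance Definition _ := Finite_isGroup.Build (wreath Q A)
  wreath_mulA wreath_mul1g wreath_mulVg.

Lemma wreathM (x y : wreath Q A) :
  x * y = (x.1 * y.1, [ffun Y => x.2 Y * y.2 (Y :* x.1)]).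
Proof. by []. Qed.

Lemma wreath_pgroup (p : nat) :
  p.-group [set: Q] -> p.-group [set: A] -> p.-group [set: wreath Q A].
Proof.
rewrite /pgroup !cardsT => pQ pA.
by rewrite card_prod card_ffun pnatM pQ pnatX pA.
Qed.

End Wreath.

(* Kaloujnine-Krasner: q |-> (q, Y |-> phi (r Y * q * (r (Y q))^-1)), with r a
   choice of coset representatives, embeds Q into a wreath product in such a
   way that evaluation at the trivial coset P recovers phi on P. *)
Lemma coinduced_embedding_problem (p : nat) (Q A B : finGroupType) (P : {group Q})
    (phi : Q -> B) (pi : A -> B) :
  p.-group [set: Q] -> p.-group [set: A] ->
  (forall x y, x \in P -> y \in P -> phi (x * y) = phi x * phi y) ->
  {morph pi : x y / x * y} -> (forall b, exists a, pi a = b) ->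
  exists (C D : finGroupType) (rho : C -> D) (tau : Q -> D) (theta : C -> A),
    [/\ p.-group [set: C], {morph rho : x y / x * y}, forall d, exists c, rho c = d,
        {morph tau : x y / x * y}
      & forall c q, q \in P -> rho c = tau q -> pi (theta c) = phi q /\
          forall c', theta (c * c') = theta c * theta c'].
Proof.
move=> pQ pA phiM piM pi_surj.
(* The default value 1 is given to the subsets of Q that are not cosets of P; right translation
   permutes these among themselves, so the cocycle identity [kappaM] holds for all Y. *)
pose kappa (q : Q) (Y : {set Q}) : B :=
  if Y \in rcosets P [set: Q] then phi (fingroup.repr Y * q * (fingroup.repr (Y :* q))^-1) else 1.
have rY Y q : Y \in rcosets P [set: Q] ->
    Y :* q \in rcosets P [set: Q] /\ fingroup.repr Y * q * (fingroup.repr (Y :* q))^-1 \in P.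
  move=> /rcosetsP[y _ ->]; rewrite -rcosetM; split.
    by apply/rcosetsP; exists (y * q).
  have /rcosetP[a aP ->] := mem_repr_rcoset P y.
  have /rcosetP[b bP ->] := mem_repr_rcoset P (y * q).
  suff -> : a * y * q * (b * (y * q))^-1 = a * b^-1 by rewrite groupM ?groupV.
  by rewrite !invgM !mulgA !mulgK.
have kappaM q r Y : kappa (q * r) Y = kappa q Y * kappa r (Y :* q).
  rewrite /kappa; case: ifPn => [YP|nYP].
    have [YqP aP] := rY Y q YP; have [YqrP bP] := rY (Y :* q) r YqP.
    rewrite YqP -phiM //; congr phi.
    by rewrite -rcosetM !mulgA mulgVK.
  case: ifPn => [/(rY _ q^-1)[YP _]|_]; last by rewrite mulg1.
  by move: nYP; rewrite -[Y]rcoset1 -(mulgV q) rcosetM YP.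
exists (wreath Q A), (wreath Q B),
  (fun c : wreath Q A => (c.1, [ffun Y => pi (c.2 Y)]) : wreath Q B),
  (fun q => (q, [ffun Y => kappa q Y]) : wreath Q B), (fun c : wreath Q A => c.2 (P : {set Q})).
split.
- exact: wreath_pgroup.
- move=> x y; rewrite !wreathM; congr pair.
  by apply/ffunP => Y; rewrite !ffunE /= piM.
- have [s sP] := choice pi_surj; move=> [q f]; exists (q, [ffun Y => s (f Y)]) => /=.
  by congr pair; apply/ffunP => Y; rewrite !ffunE sP.
- move=> q r; rewrite wreathM; congr pair.
  by apply/ffunP => Y; rewrite !ffunE kappaM.
(* Right translation by an element q of P fixes the coset P, so evaluation at P is multiplicative at
   every c lying over such a q. *)
move=> [q' f] q qP /= [-> /ffunP/(_ (P : {set Q}))]; rewrite !ffunE => ->; split.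
  rewrite /kappa rcoset_id // repr_group mul1g invg1 mulg1.
  suff -> : (P : {set Q}) \in rcosets P [set: Q] by [].
  by apply/rcosetsP; exists 1; rewrite ?rcoset1.
by move=> c'; rewrite /= ffunE /= rcoset_id.
Qed.

(** * Compact spaces and profinite groups *)

Local Open Scope classical_set_scope.

Lemma compact_fip (T : topologicalType) (I : eqType) (C : I -> set T) :
  compact [set: T] -> (forall i, closed (C i)) ->
  (forall s : seq I, exists x, forall i, i \in s -> C i x) ->
  exists x, forall i, C i x.
Proof.
move=> cT clC finC.
pose F : set_system T := [set A | exists s : seq I, (fun x => forall i, i \in s -> C i x) `<=` A].
have FF : ProperFilter F.
  split; first by move=> [s]; have [x xs] := finC s; move=> /(_ x xs).
  split=> [|A B [s sA] [t tB]|A B AB [s sA]]; first by exists [::].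
    exists (s ++ t) => x xst; split; [apply: sA|apply: tB] => i it;
    by apply: xst; rewrite mem_cat it ?orbT.
  by exists s; apply: subset_trans AB.
have [|x [_ Fx]] := cT F FF; first by exists [::].
exists x => i; apply: clC => A Ax; apply: Fx => //.
by exists [:: i] => y; apply; rewrite mem_head.
Qed.

Lemma compact_subset_open (T : topologicalType) (I : eqType) (C : I -> set T) (U : set T) :
  compact [set: T] -> (forall i, closed (C i)) -> open U ->
  (forall x, (forall i, C i x) -> U x) ->
  exists s : seq I, forall x, (forall i, i \in s -> C i x) -> U x.
Proof.
move=> cT clC oU CU; apply: contrapT => nU.
pose D (i : option I) := if i is Some i' then C i' else ~` U.
have [||x Dx] := @compact_fip T (option I) D cT.
- by move=> [i|] //=; exact: open_closedC.
- move=> s; apply: contrapT => nD; apply: nU; exists (pmap id s) => x xs.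
  apply: contrapT => nUx; apply: nD; exists x => -[i|] //= iS.
  by apply: xs; rewrite mem_pmap map_id.
by apply: (Dx None); apply: CU => i; exact: (Dx (Some i)).
Qed.

(** In a compact Hausdorff space the quasi-component Q of x, the intersection of its clopen
    neighbourhoods, is connected, hence reduced to x here. By compactness a finite intersection of
    clopen neighbourhoods then lies in U. *)
Lemma profinite_clopen (T : topologicalType) (x : T) (U : set T) :
  compact [set: T] -> hausdorff_space T -> totally_disconnected [set: T] ->
  nbhs x U -> exists V, [/\ clopen V, V x & V `<=` U].
Proof.
move=> cT hT tdT.
pose I := {classic {V : set T | clopen V /\ V x}}.
pose mkI V (VP : clopen V /\ V x) : I := exist (fun V => clopen V /\ V x) V VP.
have clI (i : I) : closed (sval i) by case: (svalP i) => -[].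
pose Q := [set y | forall i : I, sval i y].
have clQ : closed Q.
  have -> : Q = \bigcap_(i in [set: I]) sval i.
    by apply/seteqP; split=> y Qy i //; exact: Qy.
  exact: closed_bigI.
have bigI (s : seq I) : exists i : I, sval i `<=` [set y | forall j, j \in s -> sval j y].
  elim: s => [|j s [i iP]]; first by exists (@mkI setT (conj clopenT Logic.I)).
  have ijP : clopen (sval i `&` sval j) /\ (sval i `&` sval j) x.
    by case: (svalP i) (svalP j) => ci ix [cj jx]; split=> //; exact: clopenI.
  exists (mkI _ ijP) => y [/= iy jy] k; rewrite inE => /predU1P[->//|ks].
  exact: iP.
have smallQ W : open W -> Q `<=` W -> exists i : I, sval i `<=` W.
  move=> oW QW; have [s sP] := @compact_subset_open T I (fun i => sval i) W cT clI oW QW.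
  by have [i iP] := bigI s; exists i => y /iP/sP.
suff Q1 : Q `<=` [set x].
  rewrite nbhsE => -[W [oW Wx] WU].
  have [|i iW] := smallQ W oW; first by move=> y /Q1 ->.
  by exists (sval i); case: (svalP i) => ci ix; split=> // y /iW/WU.
have Qx : Q x by move=> i; case: (svalP i).
rewrite -(tdT x Logic.I); apply: connected_component_max => //.
move=> B B0 [O oO BO] [O' cO' BO'].
have clB : closed B by rewrite BO'; exact: closedI.
have clB' : closed (Q `\` B).
  have -> : Q `\` B = Q `&` ~` O.
    by rewrite BO setDE setCI setIUr setICr set0U.
  by apply: closedI => //; exact: open_closedC.
(* Connectedness of Q: normality gives an open W containing E whose closure avoids F. A small clopen
   neighbourhood of x misses the boundary of W, so its trace on W is again clopen and contains Q. *)
have sep (E F : set T) : closed E -> closed F -> E `&` F = set0 -> Q = E `|` F -> E x -> F = set0.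
  move=> cE cF EF QEF Ex.
  have [C + CF] : filter_from (set_nbhs E) closure (~` F).
    apply: (compact_normal hT cT cE); apply/set_nbhsP; exists (~` F).
    by split=> //; [rewrite openC|rewrite -disjoints_subset].
  move=> /set_nbhsP[W [oW EW WC]].
  have oV : open (~` closure C) by rewrite openC; exact: closed_closure.
  have QW : Q `<=` W `|` ~` closure C.
    rewrite QEF => y [/EW|Fy]; [by left|right=> Cy].
    exact: CF Cy Fy.
  have [i iW] := smallQ _ (openU oW oV) QW.
  have eiW : sval i `&` W = sval i `&` closure C.
    apply/seteqP; split=> y [iy Wy]; split=> //; first exact/subset_closure/WC.
    by case: (iW y iy).
  have [[oi ci] ix] := svalP i.
  have jP : clopen (sval i `&` W) /\ (sval i `&` W) x.
    split; last by split=> //; exact: EW.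
    split; first exact: openI.
    by rewrite eiW; apply: closedI => //; exact: closed_closure.
  apply/seteqP; split=> // y Fy.
  have Qy : Q y by rewrite QEF; right.
  have [_ Wy] := Qy (mkI _ jP).
  by apply: (CF y) Fy; exact/subset_closure/WC.
have QBB : Q = B `|` (Q `\` B) by rewrite setDUK // BO; exact: subIsetl.
have [Bx|nBx] := pselect (B x).
  by rewrite [RHS]QBB (sep B (Q `\` B)) ?setU0 ?setDIK.
have := sep (Q `\` B) B clB' clB; rewrite setUC -QBB setIC setDIK.
move=> /(_ erefl erefl (conj Qx nBx)) B_0.
by case: B0; rewrite B_0.
Qed.

Section FiniteQuotient.
Variables (Gam : groupType) (N : fin_normal Gam).

(** Indices into an enumeration of the cosets make [quot N] a finite type; with its group structure
    it becomes a finite group. *)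
Let coset_seq_ex := iffLR (@finite_seqP {classic set Gam} _) (fin_normal_finite N).

Let coset_seq : seq {classic set Gam} := sval (cid coset_seq_ex).

Let mem_coset_seq (C : set Gam) : (C \in coset_seq) = (C \in cosets N).
Proof.
have e : (cosets N : set {classic set Gam}) = [set` coset_seq] := svalP (cid coset_seq_ex).
by rewrite e; apply/idP/idP; rewrite inE.
Qed.

Let quot_code (C : quot N) : option 'I_(size coset_seq) :=
  insub (index (val C : {classic set Gam}) coset_seq).

Let quot_decode (i : option 'I_(size coset_seq)) : option (quot N) :=
  obind (fun i : 'I_(size coset_seq) =>
    insub (nth (Defs.lcoset N 1 : {classic set Gam}) coset_seq i)) i.

Let quot_codeK : pcancel quot_code quot_decode.
Proof.
move=> C; have Cs : (val C : {classic set Gam}) \in coset_seq.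
  by rewrite mem_coset_seq; exact: valP.
by rewrite /quot_code insubT ?index_mem //= nth_index // valK.
Qed.

HB.instance Definition _ : isCountable (quot N) := PCanIsCountable quot_codeK.
HB.instance Definition _ : isFinite (quot N) := PCanIsFinite quot_codeK.

Lemma card_quot n : (cosets N #= `I_n)%card -> #|{: quot N}| = n.
Proof.
move=> cN; apply/card_eq_II; rewrite -(card_eqr cN) card_eq_sym.
rewrite -(card_eql (card_setT (cosets N))).
apply/card_set_bijP; exists (fun C : quot N => enum_rank C : nat); split.
- by move=> C _ /=; exact: ltn_ord.
- by move=> C D _ _ /ord_inj/enum_rank_inj.
by move=> i /= ni; exists (enum_val (Ordinal ni)); rewrite ?enum_valK.
Qed.

End FiniteQuotient.

(** * Open normal subgroups of profinite groups *)

Definition subgroup_set (G : groupType) (S : set G) : Prop :=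
  [/\ S 1, forall x y, S x -> S y -> S (x * y) & forall x, S x -> S x^-1].

Lemma normal_subgroup_set (G : groupType) (N : set G) : normal_subgroup N -> subgroup_set N.
Proof. by case=> N1 NM NV _; split. Qed.

Section TopologicalGroups.
Variable G : topGroupType.
Implicit Types (S N U V : set G) (x y g h : G).

Lemma continuous_mulg (T : topologicalType) (f g : T -> G) :
  continuous f -> continuous g -> continuous (fun t => f t * g t).
Proof.
move=> cf cg t; apply: (@continuous2_cvg _ _ _ _ (nbhs t) _ f g (fun x y : G => x * y)).
- exact: (@mulg_continuous G (f t, g t)).
- exact: cf.
- exact: cg.
Qed.

Lemma continuous_invg (T : topologicalType) (f : T -> G) :
  continuous f -> continuous (fun t => (f t)^-1).
Proof. by move=> cf t; apply: (continuous_comp (cf t)); exact: invg_continuous. Qed.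

Lemma continuous_mulgl g : continuous (fun x => g * x).
Proof. by apply: continuous_mulg; [move=> ?; exact: cvg_cst|move=> ?; exact: cvg_id]. Qed.

Lemma continuous_mulgr g : continuous (fun x => x * g).
Proof. by apply: continuous_mulg; [move=> ?; exact: cvg_id|move=> ?; exact: cvg_cst]. Qed.

Lemma nbhs_mulgl g U : nbhs 1 U -> nbhs g [set x | U (g^-1 * x)].
Proof.
move=> U1; apply: (@continuous_mulgl g^-1 g U).
by rewrite mulVg.
Qed.

Lemma subgroup_open S : subgroup_set S -> nbhs 1 S -> open S.
Proof.
move=> [S1 SM SV] nS; rewrite openE => x Sx.
by apply: filterS (nbhs_mulgl x nS) => y /= /(SM _ _ Sx); rewrite mulVKg.
Qed.

Lemma open_subgroup_closed S : subgroup_set S -> open S -> closed S.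
Proof.
move=> [S1 SM SV] oS; rewrite -openC openE => x nSx.
have nS : nbhs (1 : G) S by exact: open_nbhs_nbhs.
apply: filterS (nbhs_mulgl x nS) => y /= Sxy Sy; apply: nSx.
by rewrite -[x]invgK -[x^-1](mulgK y); apply: (SV); apply: (SM) => //; exact: SV.
Qed.

Definition open_normal N : Prop := normal_subgroup N /\ open N.

Lemma open_normal_nbhs N : open_normal N -> nbhs 1 N.
Proof. by move=> [[N1 _ _ _] oN]; exact: open_nbhs_nbhs. Qed.

Lemma open_normal_closed N : open_normal N -> closed N.
Proof. by move=> [/normal_subgroup_set nN oN]; exact: open_subgroup_closed. Qed.

Lemma open_normalT : open_normal setT.
Proof. by split; [split|exact: openT]. Qed.

Lemma open_normalI M N : open_normal M -> open_normal N -> open_normal (M `&` N).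
Proof.
move=> [[M1 MM MV MJ] oM] [[N1 NM NV NJ] oN]; split; last exact: openI.
split=> // [x y [Mx Nx] [My Ny]|x [Mx Nx]|x g [Mx Nx]]; split;
  by [exact: MM|exact: NM|exact: MV|exact: NV|exact: MJ|exact: NJ].
Qed.

(** For a clopen V inside U, take the g all of whose conjugates stabilise V under right
    multiplication. They form a normal subgroup, contained in V because V contains 1. *)
Lemma open_normal_basis U : profinite G -> nbhs 1 U ->
  exists N, open_normal N /\ N `<=` U.
Proof.
move=> [cG hG tdG] nU; have [V [[oV cV] V1 VU]] := profinite_clopen cG hG tdG nU.
pose P (g : G) (z : G * G) := V z.2 = V (z.2 * (z.1^-1 * g * z.1)).
have cGG : compact [set: G * G] by rewrite -setXTT; exact: compact_setX.
have nP : \forall g \near (1 : G), forall z, [set: G * G] z -> P g z.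
  (* Tube argument: near each z the condition holds for g close to 1, because V and its complement
     are both open; compactness of the square of G makes the neighbourhood of 1 uniform in z. *)
  apply: (iffLR (compact_near_coveringP _) cGG) => z _.
  pose f (w : (G * G) * G) := w.1.2 * (w.1.1^-1 * w.2 * w.1.1).
  have c1 : continuous (fun w : (G * G) * G => w.1.1).
    by move=> w; apply: (@continuous_comp _ _ _ fst fst) => /=; exact: cvg_fst.
  have c2 : continuous (fun w : (G * G) * G => w.1.2).
    by move=> w; apply: (@continuous_comp _ _ _ fst snd) => /=; [exact: cvg_fst|exact: cvg_snd].
  have c3 : continuous (fun w : (G * G) * G => w.2) by move=> w; exact: cvg_snd.
  have cf : continuous f.
    by do ![apply: continuous_mulg => // | apply: continuous_invg => //].
  have fz : f (z, 1) = z.2 by rewrite /f /= mulg1 mulVg mulg1.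
  have near1 (W : set G) : open W -> W z.2 -> nbhs (z, 1 : G) [set w | W w.1.2 /\ W (f w)].
    move=> oW Wz; apply: filterI.
      by apply: (c2 (z, 1)); exact: open_nbhs_nbhs.
    by apply: (cf (z, 1)); apply: open_nbhs_nbhs; rewrite fz.
  have [Vz|nVz] := pselect (V z.2).
    by apply: filterS (near1 V oV Vz) => w [Vw Vf]; apply/propext; split.
  have oV' : open (~` V) by rewrite openC.
  by apply: filterS (near1 (~` V) oV' nVz) => w [Vw Vf]; apply/propext; split=> [/Vw|/Vf].
pose N := [set g | forall z, P g z].
have NM x y : N x -> N y -> N (x * y).
  move=> Nx Ny [a v]; rewrite /P /= (Nx (a, v)) /= (Ny (a, v * (a^-1 * x * a))) /=.
  by rewrite !mulgA mulgK.
have NV x : N x -> N x^-1.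
  move=> Nx [a v]; rewrite /P /= (Nx (a, v * (a^-1 * x^-1 * a))) /=.
  by rewrite !mulgA !(mulgK, mulgVK).
have nN : normal_subgroup N.
  split=> // [[a v]|x g Nx [a v]]; first by rewrite /P /= mulg1 mulVg mulg1.
  by rewrite /P /= (Nx (g * a, v)) /= invgM !mulgA.
exists N; split; last first.
  by move=> x /(_ (1, 1)); rewrite /P /= !mul1g invg1 mulg1 mul1g => e; apply: VU; rewrite -e.
split=> //; apply: subgroup_open; first exact: normal_subgroup_set.
by apply: filterS nP => g + z; apply.
Qed.

Lemma open_normal_sep x : profinite G -> (forall N, open_normal N -> N x) -> x = 1.
Proof.
move=> pG Nx; case: (pG) => _ hG _; apply: hG => A B Ax B1.
have [N [oN NB]] := open_normal_basis pG B1.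
by exists x; split; [exact: nbhs_singleton|apply: NB; exact: Nx].
Qed.

Lemma open_normal_finite N : compact [set: G] -> open_normal N -> finite_set (cosets N).
Proof.
move=> cG oN; have [[N1 NM NV NJ] opN] := oN.
have clC (g : {classic G}) : closed [set h | ~ N (g^-1 * h)].
  apply: (iffLR (continuous_closedP _) (@continuous_mulgl g^-1) (~` N)).
  by rewrite closedC.
have [|s sP] := @compact_subset_open G {classic G} _ set0 cG clC open0.
  by move=> x /(_ x) /=; rewrite mulVg; apply.
apply: (@sub_finite_set _ _ [set Defs.lcoset N g | g in [set` s]]).
  move=> _ [x _ <-]; apply: contrapT => nx; apply: (sP x) => g gs Nx; apply: nx.
  exists g => //; apply/seteqP; split=> y /Defs.mem_lcoset Ny; apply/Defs.mem_lcoset.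
    by rewrite -[y](mulKVg g) mulgA -[x^-1 * g]invgK invgM invgK; apply: NM Ny; exact: NV.
  by rewrite -[y](mulKVg x) mulgA; exact: NM.
by apply: finite_image; exact: finite_seq.
Qed.

Definition open_fin_normal (cG : compact [set: G]) N (oN : open_normal N) : fin_normal G :=
  FinNormal oN.1 (open_normal_finite cG oN).

Lemma closed_approx S x : profinite G -> closed S ->
  (forall N, open_normal N -> exists2 y, S y & N (x^-1 * y)) -> S x.
Proof.
move=> pG cS Sx; apply: contrapT => nSx.
have oS : open (~` S) by rewrite openC.
have n1 : nbhs (1 : G) [set y | (~` S) (x * y)].
  by apply: (@continuous_mulgl x 1); rewrite mulg1; exact: open_nbhs_nbhs.
have [N [oN NS]] := open_normal_basis pG n1.
by have [y Sy /NS] := Sx N oN; rewrite /= mulVKg.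
Qed.

End TopologicalGroups.

(** * Embedding problems *)

Lemma morph_of1 (G H : groupType) (f : G -> H) : {morph f : x y / x * y} -> f 1 = 1.
Proof. by move=> fM; apply: (@mulgI _ (f 1)); rewrite -fM !mulg1. Qed.

Lemma morph_ofV (G H : groupType) (f : G -> H) x : {morph f : x y / x * y} -> f x^-1 = (f x)^-1.
Proof.
by move=> fM; apply: (@mulgI _ (f x)); rewrite -fM !mulgV morph_of1.
Qed.

Lemma morph_ofX (G H : groupType) (f : G -> H) x n :
  {morph f : x y / x * y} -> f (x ^+ n) = f x ^+ n.
Proof.
move=> fM; elim: n => [|n IH]; first by rewrite !expg0 morph_of1.
by rewrite !expgS fM IH.
Qed.

Lemma pgroup_root (p q : nat) (A : finGroupType) (x : A) :
  p.-group [set: A]%SET -> prime p -> prime q -> q != p -> exists y, y ^+ q = x.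
Proof.
move=> pA pr_p pr_q qp; have cq : coprime #|[set: A]%SET| q.
  by apply: pnat_coprime pA _; rewrite pnatE // !inE eq_sym.
exists (x ^+ expg_invn [set: A]%SET q).
by rewrite -expgM mulnC expgM expgK // finset.in_setT.
Qed.

(** Roots of order q != p pass to images, and by [pgroup_of_roots] they force a finite group to be a
    p-group. *)
Lemma pgroup_surj (p : nat) (A B : finGroupType) (f : A -> B) :
  prime p -> p.-group [set: A]%SET -> {morph f : x y / x * y} ->
  (forall b, exists a, f a = b) -> p.-group [set: B]%SET.
Proof.
move=> pr pA fM fS; apply: pgroup_of_roots => q pr_q qp b.
have [a <-] := fS b; have [y <-] := pgroup_root a pA pr pr_q qp.
by exists (f y); rewrite morph_ofX.
Qed.

Lemma pgroup_quot_card (p : nat) (G : groupType) (N : fin_normal G) :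
  p.-group [set: quot N]%SET -> exists k, (cosets N #= `I_(p ^ k)%N)%card.
Proof.
have [n cN] := iffLR (finite_setP (cosets N)) (fin_normal_finite N).
rewrite /pgroup cardsT (card_quot cN) => /p_natP[k nk].
by exists k; rewrite -nk.
Qed.

Lemma pro_p_quot (p : nat) (P : topGroupType) (N : fin_normal P) :
  prime p -> pro_p p P -> open (N : set P) -> p.-group [set: quot N]%SET.
Proof.
move=> pr [_ pP] oN; have [k cN] := pP N (fin_normalP N) oN.
by rewrite /pgroup cardsT (card_quot cN) pnatX pnat_id.
Qed.

(** Continuity is expressed through the kernel, so that A needs no topology. *)
Definition cts_hom (P : topGroupType) (A : finGroupType) (f : P -> A) : Prop :=
  {morph f : x y / x * y} /\ nbhs 1 [set x | f x = 1].

(* Projectivity with respect to finite p-groups, continuous and abstract. *)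
Definition cts_ep (p : nat) (P : topGroupType) : Prop :=
  forall (A B : finGroupType) (pi : A -> B) (phi : P -> B),
    p.-group [set: A]%SET -> {morph pi : x y / x * y} ->
    (forall b, exists a, pi a = b) -> cts_hom phi ->
    exists2 psi : P -> A, cts_hom psi & forall x, pi (psi x) = phi x.

Definition abs_ep (p : nat) (G : groupType) : Prop :=
  forall (A B : finGroupType) (pi : A -> B) (phi : G -> B),
    p.-group [set: A]%SET -> {morph pi : x y / x * y} ->
    (forall b, exists a, pi a = b) -> {morph phi : x y / x * y} ->
    exists2 psi : G -> A, {morph psi : x y / x * y} & forall x, pi (psi x) = phi x.

(** An alias carrying the discrete topology, so that finite p-groups can be targets of the universal
    property. *)
Definition discrete_group (A : finGroupType) : Type := A.

Section DiscreteGroup.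
Variable A : finGroupType.
HB.instance Definition _ := FinGroup.on (discrete_group A).
HB.instance Definition _ := Topological.copy (discrete_group A) (discrete_topology A).
HB.instance Definition _ := DiscreteTopology.copy (discrete_group A) (discrete_topology A).

Lemma continuous_to_discrete (T : topologicalType) (f : T -> discrete_group A) :
  (forall t, nbhs t [set u | f u = f t]) -> continuous f.
Proof.
move=> ft t U /nbhs_singleton Ut; apply: filterS (ft t) => u /= fu.
by rewrite fu.
Qed.

Let discrete_mul_continuous :
  continuous (fun xy : discrete_group A * discrete_group A => xy.1 * xy.2 : discrete_group A).
Proof.
apply: continuous_to_discrete => -[x y]; exists ([set x], [set y]); first by split; exact: discrete_set1.
by move=> [u v] /= [-> ->].
Qed.

Let discrete_inv_continuous : continuous (fun x : discrete_group A => x^-1).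
Proof.
apply: continuous_to_discrete => x; have := @discrete_set1 (discrete_group A) x.
by apply: (@filterS _ (nbhs x)) => y ->.
Qed.

HB.instance Definition _ := isTopologicalGroup.Build (discrete_group A)
  discrete_mul_continuous discrete_inv_continuous.

Lemma discrete_group_profinite : profinite (discrete_group A).
Proof.
split; first by apply: finite_compact; exact: finite_finset.
  exact: discrete_hausdorff.
by apply: zero_dimension_totally_disconnected; exact: discrete_zero_dimension.
Qed.

Lemma discrete_group_pro_p (p : nat) : prime p -> p.-group [set: A]%SET -> pro_p p (discrete_group A).
Proof.
move=> pr pA; split=> [|N nN oN]; first exact: discrete_group_profinite.
have [cA _ _] := discrete_group_profinite.
apply: (@pgroup_quot_card p _ (open_fin_normal cA (conj nN oN))).
apply: (@pgroup_surj p A _ (to_quot (open_fin_normal cA (conj nN oN)))) => //.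
  by move=> x y; rewrite to_quotM.
exact: to_quot_ex.
Qed.

End DiscreteGroup.

Lemma discrete_nbhs (T : topologicalType) (A : finGroupType) (f : T -> discrete_group A) t :
  continuous f -> nbhs t [set u | f u = f t].
Proof. by move=> fc; apply: (fc t [set f t]); exact: discrete_set1. Qed.

Lemma continuous_discrete_comp (T : topologicalType) (A B : finGroupType)
    (f : T -> discrete_group A) (h : A -> B) :
  continuous f -> continuous (h \o f : T -> discrete_group B).
Proof.
move=> fc; apply: continuous_to_discrete => t.
by apply: (@filterS _ (nbhs t)) (discrete_nbhs t fc) => u /= ->.
Qed.

Lemma cts_hom_continuous (P : topGroupType) (A : finGroupType) (f : P -> A) :
  cts_hom f -> continuous (f : P -> discrete_group A).
Proof.
move=> [fM f1]; apply: continuous_to_discrete => x.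
apply: filterS (nbhs_mulgl x f1) => y /=; rewrite fM morph_ofV // => e.
by rewrite -[RHS]mulg1 -e mulVKg.
Qed.

Lemma continuous_cts_hom (P : topGroupType) (A : finGroupType) (f : P -> discrete_group A) :
  {morph f : x y / x * y} -> continuous f -> cts_hom (f : P -> A).
Proof.
move=> fM fc; split=> //; apply: (fc 1 [set 1]); rewrite morph_of1 //.
Qed.

Lemma free_pro_p_pro_p (p : nat) (F : topGroupType) : free_pro_p p F -> pro_p p F.
Proof. by move=> [X [i []]]. Qed.

(** Lift the images of the basis through a set-theoretic section of pi and extend by freeness; the
    extension lifts phi by the uniqueness clause applied to B. *)
Lemma free_pro_p_cts_ep (p : nat) (F : topGroupType) : prime p -> free_pro_p p F -> cts_ep p F.
Proof.
move=> pr [X [i [pF ci i1 univ]]] A B pi phi pA piM piS phiP.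
have [phiM _] := phiP; have pB := pgroup_surj pr pA piM piS.
have [s0 s0P] := choice piS.
(* The section is normalised at 1 so that the map on generators remains pointed. *)
pose s b := if b == 1 then 1 else s0 b.
have sP b : pi (s b) = b by rewrite /s; case: eqVneq => [->|_]; rewrite ?morph_of1.
have phic := cts_hom_continuous phiP.
have ic : continuous (phi \o i : _ -> discrete_group B).
  by move=> x; exact: (continuous_comp (ci x) (phic (i x))).
have fc : continuous (s \o (phi \o i) : _ -> discrete_group A).
  exact: continuous_discrete_comp.
have f1 : (s \o (phi \o i)) None = 1 :> A.
  by rewrite /= i1 morph_of1 // /s eqxx.
have [psi [[psic psiM psiE] _]] := univ (discrete_group A) _ (discrete_group_pro_p pr pA) fc f1.
exists psi; first exact: continuous_cts_hom.
have ic1 : (phi \o i) None = 1 :> B by rewrite /= i1 morph_of1.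
have [f0 [_ f0U]] := univ (discrete_group B) _ (discrete_group_pro_p pr pB) ic ic1.
have e1 : f0 = phi by apply: f0U; split.
have e2 : f0 = pi \o psi.
  apply: f0U; split.
  - exact: (@continuous_discrete_comp _ A B psi pi psic).
  - by move=> x y; rewrite /= psiM piM.
  - by apply/funext => x /=; have := congr1 (fun f => pi (f x)) psiE; rewrite /= sP.
by move=> x; rewrite -[LHS]/((pi \o psi) x) -e2 e1.
Qed.

(** * Topologically finitely generated subgroups *)

Definition quot_image (P : groupType) (N : fin_normal P) (S : set P) : {set quot N}%type :=
  [set q | `[< exists2 x, S x & to_quot N x = q >]]%SET.

Lemma mem_quot_image (P : groupType) (N : fin_normal P) (S : set P) q :
  reflect (exists2 x, S x & to_quot N x = q) (q \in quot_image N S).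
Proof. by rewrite finset.in_set; exact: asboolP. Qed.

Lemma quot_image_group (P : groupType) (N : fin_normal P) (S : set P) :
  subgroup_set S -> group_set (quot_image N S).
Proof.
move=> [S1 SM SV]; apply/group_setP; split; first by apply/mem_quot_image; exists 1.
move=> q r /mem_quot_image[x Sx <-] /mem_quot_image[y Sy <-].
by apply/mem_quot_image; exists (x * y); [exact: SM|rewrite to_quotM].
Qed.

(** On S, phi factors through the image of S in Q = P / U. The coinduced problem is defined on all
    of Q, so it inflates to a continuous problem on P, where [cts_ep] applies; [theta] extracts from
    its solution a lift on S. *)
Lemma cts_ep_subgroup (p : nat) (P : topGroupType) (S U : set P) (A B : finGroupType)
    (pi : A -> B) (phi : P -> B) :
  prime p -> pro_p p P -> cts_ep p P -> subgroup_set S -> open_normal U ->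
  p.-group [set: A]%SET -> {morph pi : x y / x * y} ->
  (forall b, exists a, pi a = b) -> {morph phi : x y / x * y} ->
  (forall x, S x -> U x -> phi x = 1) ->
  exists psi : P -> A, (forall x y, S x -> S y -> psi (x * y) = psi x * psi y) /\
    forall x, S x -> pi (psi x) = phi x.
Proof.
move=> pr pP epP gS oU pA piM piS phiM kphi; have [S1 SM SV] := gS.
have cP : compact [set: P] by case: pP => -[].
pose N := open_fin_normal cP oU; pose Q := quot N.
have pQ : p.-group [set: Q]%SET by apply: (pro_p_quot pr pP); exact: oU.2.
pose PQ := Group (@quot_image_group P N _ gS).
have [f fP] : exists f : Q -> B, forall x, S x -> f (to_quot N x) = phi x.
  have h (q : Q) : exists b : B, forall x, S x -> to_quot N x = q -> phi x = b.
    have [[x Sx <-]|nx] := pselect (exists2 x, S x & to_quot N x = q).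
      exists (phi x) => y Sy /esym/to_quot_eq Nxy.
      have : phi (x^-1 * y) = 1 by apply: kphi => //; apply: SM => //; exact: SV.
      by rewrite phiM morph_ofV // => e; rewrite -[RHS]mulg1 -e mulVKg.
    by exists 1 => x Sx xq; case: nx; exists x.
  by have [f fP] := choice h; exists f => x Sx; exact/esym/fP.
have fM x y : x \in PQ -> y \in PQ -> f (x * y) = f x * f y.
  move=> /mem_quot_image[a Sa <-] /mem_quot_image[b Sb <-].
  by rewrite -[_ * _]to_quotM !fP ?phiM //; exact: SM.
have [C [D [rho [tau [theta [pC rhoM rhoS tauM thetaP]]]]]] :=
  coinduced_embedding_problem pQ pA fM piM piS.
have tc : cts_hom (tau \o to_quot N).
  split=> [x y|]; first by rewrite /= to_quotM tauM.
  apply: filterS (open_normal_nbhs oU) => x Ux /=.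
  have -> : to_quot N x = 1 by apply/esym/to_quot_eq; rewrite /= invg1 mul1g.
  exact: morph_of1.
have [psi [psiM _] psiP] := epP C D rho _ pC rhoM rhoS tc.
have inPQ x : S x -> to_quot N x \in PQ by move=> Sx; apply/mem_quot_image; exists x.
exists (theta \o psi); split=> [x y Sx Sy|x Sx] /=.
  by rewrite psiM; have [_ ->] := thetaP _ _ (inPQ x Sx) (psiP x).
by have [-> _] := thetaP _ _ (inPQ x Sx) (psiP x); rewrite fP.
Qed.

Section TopologicallyFinitelyGenerated.
Variable P : topGroupType.

Definition topgen (s : seq P) : set P :=
  [set x | forall S, subgroup_set S -> closed S -> (forall g, g \in s -> S g) -> S x].

Lemma topgen_subgroup s : subgroup_set (topgen s).
Proof.
split=> [S []//|x y sx sy S gS cS sS|x sx S gS cS sS]; case: (gS) => _ SM SV.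
  by apply: SM; [exact: sx|exact: sy].
by apply: SV; exact: sx.
Qed.

Lemma topgen_closed s : closed (topgen s).
Proof.
have -> : topgen s = \bigcap_(S in [set S | [/\ subgroup_set S, closed S & forall g, g \in s -> S g]]) S.
  apply/seteqP; split=> [x sx S [? ? ?]|x sx S ? ? ?]; first exact: sx.
  by apply: (sx S); split.
by apply: closed_bigI => S [].
Qed.

Lemma mem_topgen s g : g \in s -> topgen s g.
Proof. by move=> gs S _ _; apply. Qed.

Lemma quot_topgen (N : fin_normal P) s x : open (N : set P) -> topgen s x ->
  to_quot N x \in <<[set q in map (to_quot N) s]%SET>>.
Proof.
move=> oN sx; pose W := [set y | to_quot N y \in <<[set q in map (to_quot N) s]%SET>>].
have gW : subgroup_set W.
  split=> [|y z|y]; rewrite /W /mkset; first exact: group1.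
    by rewrite to_quotM; exact: groupM.
  by rewrite to_quotV; exact: groupVr.
apply: (sx W gW) => [|g gs]; last by rewrite /W /mkset mem_gen // inE map_f.
apply: open_subgroup_closed => //; apply: subgroup_open => //.
apply: filterS (open_normal_nbhs (conj (fin_normalP N) oN)) => y Ny; rewrite /W /mkset.
have -> : to_quot N y = 1 by apply/esym/to_quot_eq; rewrite invg1 mul1g.
exact: group1.
Qed.

Lemma compact_setg (A B : set P) : compact A -> compact B -> compact [set a * b | a in A & b in B].
Proof.
move=> cA cB.
have -> : [set a * b | a in A & b in B] = (fun z : P * P => z.1 * z.2) @` (A `*` B).
  apply/seteqP; split=> [_ [a Aa [b Bb <-]]|_ [[a b] [/= Aa Bb] <-]]; first by exists (a, b).
  by exists a => //; exists b.
apply: continuous_compact; last exact: compact_setX.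
by apply: continuous_subspaceT; exact: mulg_continuous.
Qed.

Lemma compact_comm_product (S : set P) s : compact S -> compact (comm_product S s).
Proof.
move=> cS; elim: s => [|g s IH] /=; first exact: compact_set1.
have -> : (fun z => exists x y, [/\ S x, comm_product S s y & z = [~ x, g] * y])
  = [set a * b | a in (fun x => [~ x, g]) @` S & b in comm_product S s].
  apply/seteqP; split=> [_ [x [y [Sx cy ->]]]|_ [_ [x Sx <-] [y cy <-]]]; last by exists x, y.
  by exists [~ x, g]; [exists x|exists y].
apply: compact_setg => //; apply: continuous_compact cS; apply: continuous_subspaceT.
have ci : continuous (fun x : P => x) by move=> x; exact: cvg_id.
have cc (h : P) : continuous (fun _ : P => h) by move=> x; exact: cvg_cst.
by do ![apply: continuous_mulg => // | apply: continuous_invg => //].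
Qed.

Lemma compact_power (S : set P) n : compact S -> compact [set x ^+ n | x in S].
Proof.
move=> cS; apply: continuous_compact cS; apply: continuous_subspaceT.
elim: n => [|n IH]; first by move=> x; exact: cvg_cst.
have -> : (fun x : P => x ^+ n.+1) = (fun x => x * x ^+ n) by apply/funext => x; rewrite expgS.
by apply: continuous_mulg => // x; exact: cvg_id.
Qed.

(** The shape of the product does not depend on the quotient, and for each of the finitely many h
    the products of this shape form a compact set. If x were in none of these sets, one open normal
    subgroup would separate it from all of them, against [nilpotent_product] in the finite
    quotient. *)
Lemma topgen_product (p : nat) s x : prime p -> pro_p p P -> topgen s x ->
  exists h y c, [/\ h \in small_products p s, topgen s y, comm_product (topgen s) s c
    & x = h * y ^+ p * c].
Proof.
move=> pr pP sx; set S := topgen s in sx *.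
have [S1 SM SV] : subgroup_set S := topgen_subgroup s.
have proP : profinite P by case: pP.
have [cP hP _] := proP.
have cS : compact S by apply: subclosed_compact cP _ => //; exact: topgen_closed.
pose T h := [set a * b | a in (fun y => h * y) @` [set y ^+ p | y in S] & b in comm_product S s].
have clT h : closed (T h).
  apply: compact_closed => //; apply: compact_setg; last exact: compact_comm_product.
  apply: continuous_compact; last exact: compact_power.
  by apply: continuous_subspaceT; exact: continuous_mulgl.
suff [h hs [_ [_ [y Sy <-] <-] [c cc e]]] : exists2 h, h \in small_products p s & T h x.
  by exists h, y, c; split.
apply: contrapT => nT.
have sep h : h \in small_products p s -> exists N, open_normal N /\ forall t, T h t -> ~ N (x^-1 * t).
  move=> hs; apply: contrapT => nN; apply: nT; exists h => //.
  apply: closed_approx => // N oN; apply: contrapT => nt; apply: nN; exists N; split=> // t Tt Nt.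
  by apply: nt; exists t.
have [N [oN NP]] : exists N, open_normal N /\
    forall h, h \in small_products p s -> forall t, T h t -> ~ N (x^-1 * t).
  elim: (small_products p s) sep => [|h l IH] sep;
    first by exists setT; split=> //; exact: open_normalT.
  have [h' hl|M [oM MP]] := IH; first by apply: sep; rewrite inE hl orbT.
  have [N [oN NP]] := sep h (mem_head _ _).
  exists (M `&` N); split; first exact: open_normalI.
  by move=> h'; rewrite inE => /predU1P[->|/MP h'P] t Tt [Mt Nt]; [apply: (NP t)|apply: (h'P t)].
pose M := open_fin_normal cP oN.
have oM : open (M : set P) := oN.2.
pose G := <<[set q in map (to_quot M) s]%SET>>%G.
have pG : p.-group G by apply: pgroupS (pro_p_quot pr pP oM); exact: finset.subsetT.
have sS g : g \in s -> S g := @mem_topgen s g.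
have GS q : q \in G -> exists2 y, S y & to_quot M y = q.
  have : G \subset Group (@quot_image_group P M _ (topgen_subgroup s)).
    rewrite gen_subG; apply/fintype.subsetP => r; rewrite inE => /mapP[g gs ->].
    by apply/mem_quot_image; exists g => //; exact: sS.
  by move=> /fintype.subsetP GS qG; apply/mem_quot_image; exact: GS.
have fM y z : S y -> S z -> to_quot M (y * z) = to_quot M y * to_quot M z.
  by move=> _ _; exact: to_quotM.
have [h' [y' [c' [h's _ y'G c'c e]]]] :=
  nilpotent_product (prime_gt0 pr) (pgroup_nil pG) (erefl _) (quot_topgen oM sx).
have [h [hs Sh eh]] := small_products_lift S1 SM fM sS h's.
have [y Sy ey] := GS _ y'G.
have [c [cc Sc ec]] := comm_product_lift S1 SM SV fM sS GS c'c.
apply: (NP h hs (h * y ^+ p * c)).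
  by exists (h * y ^+ p); [exists (y ^+ p) => //; exists y|exists c].
apply: (iffLR (@to_quot_eq _ M x (h * y ^+ p * c))).
rewrite e (to_quotM M (h * y ^+ p) c) (to_quotM M h (y ^+ p)).
by rewrite (morph_ofX y p (@to_quotM _ M : {morph to_quot M : x y / x * y})) eh ec ey.
Qed.

End TopologicallyFinitelyGenerated.

(** * Continuity of abstract homomorphisms on finitely generated closed subgroups *)

Lemma closed_translates (P : topGroupType) (M : set P) (R : seq P) :
  closed M -> closed [set x | exists2 r, r \in R & M (r^-1 * x)].
Proof.
move=> cM; elim: R => [|r R IH].
  by have -> : [set x | exists2 r, r \in [::] & M (r^-1 * x)] = set0;
    [apply/seteqP; split=> x // -[]|exact: closed0].
have -> : [set x | exists2 r', r' \in r :: R & M (r'^-1 * x)] =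
    [set x | M (r^-1 * x)] `|` [set x | exists2 r', r' \in R & M (r'^-1 * x)].
  apply/seteqP; split=> [x [r']|x [Mx|[r' r'R Mx]]].
  - by rewrite inE => /predU1P[->|r'R] Mx; [left|right; exists r'].
  - by exists r; rewrite ?mem_head.
  - by exists r' => //; rewrite inE r'R orbT.
apply: closedU => //.
exact: (iffLR (continuous_closedP _) (@continuous_mulgl _ r^-1) M cM).
Qed.

(* Reidemeister-Schreier: M is generated by the r'^-1 * g * r that it contains. *)
Lemma topgen_subgroup_ex (P : topGroupType) (s R : seq P) (M : set P) :
  subgroup_set M -> closed M -> M `<=` topgen s ->
  (forall r, r \in R -> topgen s r) ->
  (forall x, topgen s x -> exists2 r, r \in R & M (r^-1 * x)) ->
  exists t, M = topgen t.
Proof.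
move=> gM cM MS RS SR; have [M1 MM MV] := gM.
have [S1 SM SV] := topgen_subgroup s.
pose s' := s ++ [seq g^-1 | g <- s].
(* The representatives lying in M are kept as generators too, since the coset M itself need not be
   represented by 1. *)
pose t := [seq x <- R | `[< M x >]] ++
  [seq x <- [seq rr.1^-1 * (g * rr.2) | rr <- [seq (r, r') | r <- R, r' <- R], g <- s'] | `[< M x >]].
have tM x : x \in t -> M x by rewrite mem_cat !mem_filter => /orP[] /andP[/asboolP].
exists t; have gM' := topgen_subgroup t; have [M1' MM' MV'] := gM'.
have M'M x : topgen t x -> M x by move=> tx; apply: tx.
have Rt r : r \in R -> M r -> topgen t r.
  move=> rR Mr; apply: mem_topgen.
  by rewrite mem_cat mem_filter rR andbT; apply/orP; left; apply/asboolP.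
(* The closed set of products of R with [topgen t] is stable under left translation by the
   generators and their inverses. Its stabiliser [E] is a closed subgroup, so it contains
   [topgen s], and [S'] contains the orbit of 1. *)
pose S' := [set x | exists2 r, r \in R & topgen t (r^-1 * x)].
have cS' : closed S' by apply: closed_translates; exact: topgen_closed.
have S's' g x : g \in s' -> S' x -> S' (g * x).
  move=> gs [r rR tx].
  have Sg : topgen s g.
    move: gs; rewrite mem_cat => /orP[gs|/mapP[h hs ->]]; first exact: mem_topgen.
    by apply: (SV); exact: mem_topgen.
  have [r' r'R Mr] := SR (g * r) (SM _ _ Sg (RS r rR)).
  exists r' => //.
  have -> : r'^-1 * (g * x) = r'^-1 * (g * r) * (r^-1 * x) by rewrite !mulgA mulgK.
  apply: (MM') => //; apply: mem_topgen; rewrite mem_cat; apply/orP; right.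
  rewrite mem_filter; apply/andP; split; first exact/asboolP.
  apply/allpairsP; exists ((r', r), g); split=> //=.
  by apply/allpairsP; exists (r', r).
have S'1 : S' 1.
  have [r rR] := SR 1 S1; rewrite mulg1 => Mr; exists r => //; rewrite mulg1.
  by apply: (MV'); apply: Rt => //; rewrite -[r]invgK; exact: MV.
pose E := [set h | forall x, S' x -> S' (h * x) /\ S' (h^-1 * x)].
have gE : subgroup_set E.
  split=> [x S'x|a b Ea Eb x S'x|a Ea x S'x]; first by rewrite invg1 mul1g.
    by rewrite invgM -!mulgA; split;
      [apply: (Ea _ _).1; apply: (Eb _ _).1|apply: (Eb _ _).2; apply: (Ea _ _).2].
  by rewrite invgK; split; [apply: (Ea _ _).2|apply: (Ea _ _).1].
have cE : closed E.
  have -> : E = \bigcap_(x in S') ([set h | S' (h * x)] `&` [set h | S' (h^-1 * x)]).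
    by apply/seteqP; split.
  apply: closed_bigI => x _; apply: closedI.
    exact: (iffLR (continuous_closedP _) (@continuous_mulgr _ x) S' cS').
  have ci : continuous (fun h : P => h^-1 * x).
    apply: continuous_mulg; first exact: invg_continuous.
    by move=> ?; exact: cvg_cst.
  exact: (iffLR (continuous_closedP _) ci S' cS').
have SE x : topgen s x -> E x.
  move=> sx; apply: sx => // g gs y S'y; split; apply: S's' => //; rewrite mem_cat ?gs //.
  by rewrite map_f ?orbT.
apply/seteqP; split=> x; last exact: M'M.
move=> Mx; have := (SE x (MS x Mx) 1 S'1).1; rewrite mulg1 => -[r rR tx].
rewrite -[x](mulKVg r); apply: (MM') => //; apply: Rt => //.
have -> : r = x * (r^-1 * x)^-1 by rewrite invgM invgK mulKVg.
by apply: (MM) => //; apply: (MV); exact: M'M.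
Qed.

(* Serre: on a topologically finitely generated closed subgroup S, an abstract
   homomorphism to a finite p-group is continuous.  With K the Frattini
   subgroup of phi(S), topgen_product shows that S minus phi^-1(K) is a finite
   union of closed sets on which phi mod K is constant. *)
Lemma abstract_hom_continuous (p : nat) (P : topGroupType) (B : finGroupType) (phi : P -> B) s :
  prime p -> pro_p p P -> p.-group [set: B]%SET -> {morph phi : x y / x * y} ->
  exists U, open_normal U /\ forall x, topgen s x -> U x -> phi x = 1.
Proof.
move=> pr pP pB phiM; have proP : profinite P by case: pP.
pose D (s : seq P) : {set B}%type := [set b | `[< exists2 x, topgen s x & phi x = b >]]%SET.
have DP u b : reflect (exists2 x, topgen u x & phi x = b) (b \in D u).
  by rewrite finset.in_set; exact: asboolP.
have gD u : group_set (D u).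
  have [S1 SM SV] := topgen_subgroup u.
  apply/group_setP; split; first by apply/DP; exists 1; rewrite ?morph_of1.
  move=> _ _ /DP[x Sx <-] /DP[y Sy <-]; apply/DP; exists (x * y); first exact: SM.
  by rewrite phiM.
(* Induction on the order of phi(S): the subgroup [M] below has its image inside the proper subgroup
   [K]. *)
have [n] := ubnP #|D s|; elim: n s => // n IH s /ltnSE Dn.
have [D1|Dn1] := eqVneq (D s : {set B}) 1%g.
  exists setT; split; first exact: open_normalT.
  move=> x sx _; have : phi x \in D s by apply/DP; exists x.
  by rewrite D1 inE => /eqP.
have pD : p.-group (Group (gD s)) by apply: pgroupS pB; exact: finset.subsetT.
have [K [KD Kp KR]] := pgroup_power_comm pD Dn1.
pose S := topgen s; have gS : subgroup_set S := topgen_subgroup s; have [S1 SM SV] := gS.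
have phiD x : S x -> phi x \in Group (gD s) by move=> Sx; apply/DP; exists x.
pose R := small_products p s.
have idM x y : S x -> S y -> id (x * y) = id x * id y by [].
have RS r : r \in R -> S r.
  move=> rR; have rR' : r \in small_products p (map id s) by rewrite map_id.
  by have [w [_ Sw <-]] := small_products_lift S1 SM idM (@mem_topgen _ s) rR'.
have cK' u c : (forall g, g \in u -> S g) -> comm_product S u c -> phi c \in K.
  elim: u c => [|g u IHu] c uS /=; first by move->; rewrite morph_of1.
  move=> [x [y [Sx cy ->]]]; have Sg := uS g (mem_head _ _).
  have [_ eR] := partial_morphR S1 SM SV (fun x y _ _ => phiM x y) Sx Sg.
  rewrite phiM eR groupM ?KR ?phiD //.
  by apply: IHu => // h hu; apply: uS; rewrite inE hu orbT.
have cK c : comm_product S s c -> phi c \in K := cK' s c (@mem_topgen _ s).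
pose M := [set x | S x /\ phi x \in K].
have gM : subgroup_set M.
  split; first by split=> //; rewrite morph_of1.
    by move=> x y [Sx Kx] [Sy Ky]; split; [exact: SM|rewrite phiM groupM].
  by move=> x [Sx Kx]; split; [exact: SV|rewrite morph_ofV // groupV].
have MT y c : S y -> comm_product S s c -> M (y ^+ p * c).
  move=> Sy cc; split; last by rewrite phiM (morph_ofX _ _ phiM) groupM ?Kp ?cK ?phiD.
  apply: (SM); first exact: (partial_morphX S1 SM idM p Sy).1.
  by apply: comm_product_in cc => //; exact: mem_topgen.
have SR x : S x -> exists2 r, r \in R & M (r^-1 * x).
  move=> Sx; have [h [y [c [hs Sy cc ->]]]] := topgen_product pr pP Sx.
  by exists h => //; rewrite -mulgA mulKg; exact: MT.
have cP : compact [set: P] by case: proP.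
(* With b true this says that M is closed; with b false, that its complement in S is closed, so that
   M contains S [&] V for some open normal V. *)
have clB b : closed [set x | S x /\ (phi x \in K) = b].
  pose R' := [seq r <- R | (phi r \in K) == b].
  pose T := [set a * b | a in [set y ^+ p | y in S] & b in comm_product S s].
  have cS : compact S by apply: subclosed_compact cP _ => //; exact: topgen_closed.
  have clT : closed T.
    apply: compact_closed; first by case: proP.
    by apply: compact_setg; [exact: compact_power|exact: compact_comm_product].
  have -> : [set x | S x /\ (phi x \in K) = b] = [set x | exists2 r, r \in R' & T (r^-1 * x)].
    apply/seteqP; split=> x.
      move=> [Sx Kx]; have [h [y [c [hs Sy cc e]]]] := topgen_product pr pP Sx.
      exists h; last by rewrite e -mulgA mulKg; exists (y ^+ p); [exists y|exists c].
      have [_ Km] := MT y c Sy cc.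
      by rewrite mem_filter hs andbT -Kx e -mulgA phiM groupMr.
    move=> [r]; rewrite mem_filter => /andP[/eqP <- rR] [_ [y Sy <-] [c cc e]].
    have [Sm Km] := MT y c Sy cc.
    have -> : x = r * (y ^+ p * c) by rewrite e mulVKg.
    split; first by apply: (SM) => //; exact: RS.
    by rewrite phiM groupMr.
  exact: closed_translates.
have [V [oV VM]] : exists V, open_normal V /\ (S `&` V `<=` M).
  have oC : open (~` [set x | S x /\ (phi x \in K) = false]) by rewrite openC; exact: clB.
  have nC1 : (~` [set x | S x /\ (phi x \in K) = false]) 1.
    by move=> [_]; rewrite morph_of1 // group1.
  have [V [oV VC]] := open_normal_basis proP (open_nbhs_nbhs (conj oC nC1)).
  exists V; split=> // x [Sx /VC nCx]; split=> //.
  by apply: contrapT => /negP/negPf nK; apply: nCx.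
have cM : closed M by exact: clB.
(* M is closed and the finite list R meets all its left cosets in S, so M is again topologically
   finitely generated. *)
have [t Mt] : exists t, M = topgen t.
  by apply: (topgen_subgroup_ex (s := s) (R := R)) => // x [].
have Dt : #|D t| < n.
  apply: leq_trans Dn; apply: leq_ltn_trans (proper_card KD).
  apply: subset_leq_card; apply/fintype.subsetP => b /DP[x]; rewrite -Mt => -[_ Kx] <-.
  exact: Kx.
have [U [oU UP]] := IH t Dt.
exists (U `&` V); split; first exact: open_normalI.
move=> x sx [Ux Vx]; apply: UP => //; rewrite -Mt; exact: VM.
Qed.

(** * Embedding problems and roots for abstract groups *)

(** Each condition involves at most three coordinates of f, hence is closed in the compact space of
    all maps G -> A. The local f need not be homomorphisms, nor agree for different s. *)
Lemma finite_valued_hom (G : groupType) (A : finGroupType) (R : G -> A -> Prop) :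
  (forall s : seq G, exists f : G -> A, (forall x, x \in s -> R x (f x)) /\
     (forall x y, x \in s -> y \in s -> f (x * y) = f x * f y)) ->
  exists2 f : G -> A, {morph f : x y / x * y} & forall x, R x (f x).
Proof.
move=> loc; pose T := prod_topology (fun _ : G => discrete_group A).
have cT : compact [set: T].
  have cA : compact [set: discrete_group A] by case: (discrete_group_profinite A).
  have := @tychonoff G (fun _ => discrete_group A) (fun _ => setT) (fun _ => cA).
  by congr compact; apply/seteqP; split.
pose C (xy : G * G) := [set f : T | f (xy.1 * xy.2) = f xy.1 * f xy.2 :> A /\ R xy.1 (f xy.1)].
have clC xy : closed (C xy).
  rewrite -openC openE => f nCf.
  have near_x x : nbhs f [set g : T | g x = f x].
    exact: (discrete_nbhs f (@proj_continuous _ (fun _ : G => discrete_group A) x)).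
  apply: (@filterS _ (nbhs f) _ _ _ _ (filterI (near_x (xy.1 * xy.2))
    (filterI (near_x xy.1) (near_x xy.2)))) => g /= [e [e1 e2]].
  by rewrite /C /= e e1 e2.
have [s|f fP] := @compact_fip T _ C cT clC.
  have [f [fR fM]] := loc (map fst s ++ map snd s); exists f => -[x y] xys.
  have xs : x \in map fst s ++ map snd s.
    by rewrite mem_cat; apply/orP; left; apply/mapP; exists (x, y).
  have ys : y \in map fst s ++ map snd s.
    by rewrite mem_cat; apply/orP; right; apply/mapP; exists (x, y).
  by split=> /=; [exact: fM|exact: fR].
exists f => [x y|x]; first by case: (fP (x, y)).
by case: (fP (x, 1)).
Qed.

Lemma pro_p_abs_ep (p : nat) (P : topGroupType) :
  prime p -> pro_p p P -> cts_ep p P -> abs_ep p P.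
Proof.
move=> pr pP epP A B pi phi pA piM piS phiM.
have pB := pgroup_surj pr pA piM piS.
apply: (@finite_valued_hom P A (fun x a => pi a = phi x)) => s.
have [U [oU Uk]] := abstract_hom_continuous s pr pP pB phiM.
have [psi [psiM psiP]] :=
  cts_ep_subgroup pr pP epP (topgen_subgroup s) oU pA piM piS phiM Uk.
by exists psi; split=> [x xs|x y xs ys]; [apply: psiP|apply: psiM]; exact: mem_topgen.
Qed.

Definition has_roots (p : nat) (G : groupType) : Prop :=
  forall q, prime q -> q != p -> forall x : G, exists y, y ^+ q = x.

(** The set of q-th powers is compact, hence closed, and it meets every coset of every open normal
    subgroup. *)
Lemma pro_p_roots (p : nat) (P : topGroupType) : prime p -> pro_p p P -> has_roots p P.
Proof.
move=> pr pP q pr_q qp x; have proP : profinite P by case: pP.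
have [cP hP _] := proP.
have clX : closed [set y ^+ q | y in [set: P]].
  by apply: compact_closed => //; exact: compact_power.
suff [y _ <-] : [set y ^+ q | y in [set: P]] x by exists y.
apply: closed_approx => // N oN; pose M := open_fin_normal cP oN.
have [z zq] := pgroup_root (to_quot M x) (pro_p_quot (N := M) pr pP oN.2) pr pr_q qp.
have [y ey] := to_quot_ex z; exists (y ^+ q); first by exists y.
apply: (iffLR (@to_quot_eq _ M x (y ^+ q))).
by rewrite (morph_ofX y q (@to_quotM _ M : {morph to_quot M : x y / x * y})) ey.
Qed.

(** * Passage to direct limits *)

Section DirectLimits.
Variable D : dirsys.

Lemma dirlim_has_roots (p : nat) :
  (forall i, has_roots p (@ds_ob D i)) -> has_roots p (dirlim D).
Proof.
move=> rD q pr_q qp u; have [i [x ->]] := to_dirlim_ex u.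
have [y <-] := rD i q pr_q qp x; exists (to_dirlim y).
by rewrite -(morph_ofX y q (@to_dirlimM D i : {morph @to_dirlim D i : x y / x * y})).
Qed.

(** The chosen representative of u pushed to stage j; the value 1 is a default when that
    representative does not live strictly before j. *)
Let lift_to (j : ds_idx D) (u : dirlim D) : ds_ob j :=
  if pselect (ds_lt (tag (repr u)) j) is left lt then ds_map lt (tagged (repr u)) else 1.

Let lift_toE j u : ds_lt (tag (repr u)) j -> to_dirlim (lift_to j u) = u.
Proof.
move=> lt; rewrite /lift_to; case: pselect => // lt'.
by rewrite to_dirlim_map to_dirlim_repr.
Qed.

Let lift_to_map j k u (jk : ds_lt j k) : ds_lt (tag (repr u)) j ->
  lift_to k u = ds_map jk (lift_to j u).
Proof.
move=> lt; rewrite /lift_to; case: pselect => [uk|[]]; last exact: ds_ltT jk.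
by case: pselect => // uj; rewrite (ds_mapC uj jk uk).
Qed.

(** Two representatives of the same element become equal at some stage, hence at all later ones. *)
Let lift_toM (u v : dirlim D) :
  exists k, forall j, ds_lt k j -> lift_to j (u * v) = lift_to j u * lift_to j v.
Proof.
have [k1 [uk1 vk1]] := ds_dir (tag (repr u)) (tag (repr v)).
have [k2 [k12 wk2]] := ds_dir k1 (tag (repr (u * v))).
have [uk vk] := (ds_ltT uk1 k12, ds_ltT vk1 k12).
have : to_dirlim (lift_to k2 (u * v)) = to_dirlim (lift_to k2 u * lift_to k2 v).
  by rewrite to_dirlimM !lift_toE.
move=> /to_dirlim_eq[k [/= a [b e]]]; exists k => j kj.
rewrite !(lift_to_map (ds_ltT a kj)) // -ds_mapM.
by rewrite -(ds_mapC a kj (ds_ltT a kj)) e (ds_mapC b kj (ds_ltT a kj)).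
Qed.

(** Lifts chosen at different stages need not be compatible. A finite part of the limit with its
    products is however visible at a single stage j, where a lift exists; [finite_valued_hom]
    assembles these partial lifts. *)
Lemma dirlim_abs_ep (p : nat) :
  (forall i, abs_ep p (@ds_ob D i)) -> abs_ep p (dirlim D).
Proof.
move=> epD A B pi phi pA piM piS phiM.
apply: (@finite_valued_hom _ A (fun x a => pi a = phi x)) => s.
have [k kP] : exists k, forall j, ds_lt k j -> forall u, u \in s -> ds_lt (tag (repr u)) j.
  elim: s => [|u s [k kP]]; first by exists (ds_pt D).
  have [l [kl ul]] := ds_dir k (tag (repr u)); exists l => j lj v.
  rewrite inE => /predU1P[->|vs]; first exact: ds_ltT ul lj.
  by apply: kP => //; exact: ds_ltT kl lj.
have [l lP] : exists l, forall j, ds_lt l j -> forall uv, uv \in [seq (u, v) | u <- s, v <- s] ->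
    lift_to j (uv.1 * uv.2) = lift_to j uv.1 * lift_to j uv.2.
  elim: [seq _ | u <- s, v <- s] => [|[u v] r [l lP]]; first by exists (ds_pt D).
  have [m mP] := lift_toM u v; have [n [ln mn]] := ds_dir l m; exists n => j nj uv.
  rewrite inE => /predU1P[->|uvs]; first by apply: mP; exact: ds_ltT mn nj.
  by apply: lP => //; exact: ds_ltT ln nj.
have [j [kj lj]] := ds_dir k l.
have phijM : {morph phi \o @to_dirlim D j : x y / x * y}.
  by move=> x y; rewrite /= to_dirlimM phiM.
have [psi psiM psiP] := epD j A B pi _ pA piM piS phijM.
exists (psi \o lift_to j); split=> [u us|u v us vs] /=.
  by rewrite psiP /= lift_toE //; exact: kP us.
rewrite -psiM; congr psi; apply: (lP j lj (u, v)).
by apply/allpairsP; exists (u, v).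
Qed.

End DirectLimits.

(** * Profinite completions *)

Section FinNormal.
Variable G : groupType.

Lemma fin_normalT_subproof : normal_subgroup [set: G] /\ finite_set (cosets [set: G]).
Proof.
split; first by split.
apply: (@sub_finite_set _ _ [set [set: G]]); last exact: finite_set1.
move=> _ [g _ <-]; apply/seteqP; split=> // x _.
by apply/Defs.mem_lcoset.
Qed.

Lemma fin_normalI_subproof (N M : fin_normal G) :
  normal_subgroup (N `&` M) /\ finite_set (cosets (N `&` M)).
Proof.
have [[N1 NM NV NJ] [M1 MM MV MJ]] := (fin_normalP N, fin_normalP M); split.
  split=> // [x y [Nx Mx] [Ny My]|x [Nx Mx]|x g [Nx Mx]]; split;
  by [exact: NM|exact: MM|exact: NV|exact: MV|exact: NJ|exact: MJ].
apply: (@sub_finite_set _ _ [set A `&` B | A in cosets N & B in cosets M]).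
  move=> _ [g _ <-]; exists (Defs.lcoset N g); first by exists g.
  exists (Defs.lcoset M g); first by exists g.
  apply/seteqP; split=> x.
    by move=> [/Defs.mem_lcoset ? /Defs.mem_lcoset ?]; apply/Defs.mem_lcoset.
  by move=> /Defs.mem_lcoset[? ?]; split; apply/Defs.mem_lcoset.
by apply: finite_image2; exact: fin_normal_finite.
Qed.

Lemma fin_normal_bigI (s : seq (fin_normal G)) :
  exists N : fin_normal G, forall M, M \in s -> (N : set G) `<=` M.
Proof.
elim: s => [|M s [N NP]].
  by exists (FinNormal fin_normalT_subproof.1 fin_normalT_subproof.2).
have [nI fI] := fin_normalI_subproof N M.
exists (FinNormal nI fI) => K; rewrite inE => /predU1P[->|/NP NK] x [Nx Mx] //.
exact: NK.
Qed.

Lemma fin_normal_ker (A : finGroupType) (f : G -> A) :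
  {morph f : x y / x * y} -> exists N : fin_normal G, forall x, (N : set G) x <-> f x = 1.
Proof.
move=> fM; pose K := [set x | f x = 1].
have nK : normal_subgroup K.
  split=> [|x y Kx Ky|x Kx|x g Kx]; rewrite /K /mkset ?morph_of1 //.
  - by rewrite fM Kx Ky mulg1.
  - by rewrite morph_ofV // Kx invg1.
  - by rewrite !fM Kx mulg1 -fM mulVg morph_of1.
suff fK : finite_set (cosets K) by exists (FinNormal nK fK).
apply: (@sub_finite_set _ _ [set [set x | f x = a] | a in [set: A]]).
  move=> _ [g _ <-]; exists (f g) => //; apply/seteqP; split=> x.
    move=> /= e; apply/Defs.mem_lcoset; rewrite /K /mkset fM morph_ofV // e.
    exact: mulVg.
  move=> /Defs.mem_lcoset; rewrite /K /mkset fM morph_ofV // => e.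
  by rewrite -[RHS]mulg1 -e mulVKg.
by apply: finite_image; exact: finite_finset.
Qed.

End FinNormal.

Section Completion.
Variable G : groupType.
Local Notation "'hG'" := (profinite_completion G).

Lemma closed_compatible : closed (@compatible G).
Proof.
rewrite -openC openE => x nx.
have [N [M [NM nNM]]] : exists N M : fin_normal G, (N : set G) `<=` M /\
    ~ ((val (x N : quot N) : set G) `<=` val (x M : quot M)).
  apply: contrapT => h; apply: nx => N M NM; apply: contrapT => nNM.
  by apply: h; exists N, M.
have near_x K : nbhs x [set y | y K = x K].
  apply: (@proj_continuous _ (fun N : fin_normal G => discrete_topology (quot N)) K x [set x K]).
  exact: discrete_set1.
apply: (@filterS _ (nbhs x) _ _ _ _ (filterI (near_x N) (near_x M))) => y /= [eN eM] yc.
by apply: nNM; rewrite -eN -eM; exact: yc.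
Qed.

Lemma completion_compact : compact [set: hG].
Proof.
pose T := prod_topology (fun N : fin_normal G => discrete_topology (quot N)).
have cT : compact [set: T].
  have cN (N : fin_normal G) : compact [set: discrete_topology (quot N)].
    by apply: finite_compact; exact: (@finite_finset (quot N)).
  have := @tychonoff (fin_normal G) (fun N => discrete_topology (quot N)) (fun _ => setT) cN.
  by congr compact; apply/seteqP; split.
have cC : compact (@compatible G) by apply: subclosed_compact closed_compatible cT _.
move=> F FF _.
have [|p [pC Fp]] := cC (val @ F) _.
  by apply: (@filterS _ F _ setT) filterT => x _; exact: set_valP.
exists (@SigSub _ _ _ p (mem_set pC)); split=> // A B FA [B' [[O oO <-] /= Op OB]].
have [||y [[z Az <-] Oy]] := Fp (val @` A) O.
- by apply: (@filterS _ F _ A) FA => z Az; exists z.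
- exact: open_nbhs_nbhs.
by exists z; split=> //; exact: OB.
Qed.

Lemma near_pc_proj (x : hG) N : nbhs x [set t | pc_proj N t = pc_proj N x].
Proof. by apply: (@pc_proj_continuous G N x [set pc_proj N x]); exact: discrete_set1. Qed.

Lemma completion_profinite : profinite hG.
Proof.
split; first exact: completion_compact.
  move=> x y xy; apply: pc_eq => N.
  by have [t [/= <- <-]] := xy _ _ (near_pc_proj x N) (near_pc_proj y N).
apply: zero_dimension_totally_disconnected => x y xy.
have [N nN] : exists N, pc_proj N x <> pc_proj N y.
  apply: contrapT => h; move/eqP: xy; apply; apply: pc_eq => N.
  by apply: contrapT => ?; apply: h; exists N.
exists [set t | pc_proj N t = pc_proj N x]; split=> //; last by move=> /= /esym.
have : clopen (@pc_proj G N @^-1` [set pc_proj N x]); last by [].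
apply: preimage_clopen; last exact: pc_proj_continuous.
by split; [exact: discrete_open|exact: discrete_closed].
Qed.

Lemma completion_dense (x : hG) (U : set hG) : nbhs x U -> exists g, U (to_completion g).
Proof.
rewrite nbhsE => -[O [oO Ox] OU].
have [||s sP] := @compact_subset_open hG _ (fun N => [set t | pc_proj N t = pc_proj N x]) O
    completion_compact _ oO.
- move=> N; have : closed (@pc_proj G N @^-1` [set pc_proj N x]); last by [].
  apply: (iffLR (continuous_closedP _)); first exact: pc_proj_continuous.
  exact: discrete_closed.
- by move=> t tx; have -> : t = x by apply: pc_eq.
have [N NP] := fin_normal_bigI s; have [g eg] := to_quot_ex (pc_proj N x).
exists g; apply: OU; apply: sP => M Ms /=.
have [h [eN ->]] := pc_projP x (NP M Ms).
apply/to_quot_eq; apply: (NP M Ms); apply/to_quot_eq.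
by rewrite eg.
Qed.

(** By density, every coset of an open normal subgroup contains the image of an element of G, so the
    finite quotients inherit roots from G. *)
Lemma completion_pro_p (p : nat) : has_roots p G -> pro_p p hG.
Proof.
move=> rG; split=> [|N nN oN]; first exact: completion_profinite.
apply: (@pgroup_quot_card p _ (open_fin_normal completion_compact (conj nN oN))).
apply: pgroup_of_roots => q pr_q qp z; have [x <-] := to_quot_ex z.
have [g Ng] := completion_dense
  (nbhs_mulgl x (open_nbhs_nbhs (conj oN (let: And4 N1 _ _ _ := nN in N1)))).
have [h hq] := rG q pr_q qp g.
exists (to_quot _ (to_completion h)).
rewrite -(morph_ofX _ q (@to_quotM _ _ : {morph to_quot _ : x y / x * y})).
rewrite -(morph_ofX _ q (@to_completionM G)) hq.
by apply/esym/to_quot_eq.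
Qed.

(** Restrict phi to G and lift it abstractly. The kernel K of the lift has finite index, so the lift
    factors through the component of the completion at K; it still lifts phi by density of G. *)
Lemma completion_cts_ep (p : nat) : abs_ep p G -> cts_ep p hG.
Proof.
move=> epG A B pi phi pA piM piS [phiM phi1].
have pM : {morph phi \o @to_completion G : x y / x * y}.
  by move=> x y; rewrite /= to_completionM phiM.
have [psi psiM psiP] := epG A B pi _ pA piM piS pM.
have [K KP] := fin_normal_ker psiM.
pose f (x : hG) := psi (quot_repr (pc_proj K x : quot K)).
have fE x g : pc_proj K x = to_quot K g -> f x = psi g.
  move=> e; rewrite /f.
  have /to_quot_eq/KP : to_quot K g = to_quot K (quot_repr (pc_proj K x : quot K)).
    by rewrite quot_reprK.
  by rewrite psiM morph_ofV // => e'; rewrite -[RHS]mulg1 -e' mulVKg.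
exists f.
  split=> [x y|].
    have [g eg] := to_quot_ex (pc_proj K x); have [h eh] := to_quot_ex (pc_proj K y).
    rewrite (fE x g) // (fE y h) // -psiM; apply: fE.
    by rewrite to_quotM eg eh.
  by apply: filterS (near_pc_proj 1 K) => x /= /fE ->; exact: morph_of1.
move=> x; have nU : nbhs x [set t | phi t = phi x /\ pc_proj K t = pc_proj K x].
  apply: filterI; last exact: near_pc_proj.
  apply: (@discrete_nbhs _ B phi); exact: cts_hom_continuous.
have [g [<- eg]] := completion_dense nU.
by rewrite (fE x g) // psiP.
Qed.

End Completion.

(** * Projective pro-p groups are free *)

Import GRing.Theory.

(** A central extension of a smaller p-group by F_p, the latter written additively: inductions on
    the order of A reduce questions on maps into A to characters. *)
Lemma pgroup_central_layer (p : nat) (A : finGroupType) :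
  prime p -> p.-group [set: A]%SET -> 1 < #|A| ->
  exists (C : finGroupType) (q : A -> C) (e : 'F_p -> A),
    [/\ #|C| < #|A|, p.-group [set: C]%SET, {morph q : x y / x * y}
      & (forall c, exists a, q a = c)] /\
    [/\ forall a b, e (a + b)%R = e a * e b, injective e, forall a x, commute (e a) x,
        forall x, q x = 1 -> exists a, x = e a & forall a, q (e a) = 1].
Proof.
move=> pr pA A1; have [z [oz cz]] := pgroup_central_elt pA A1.
pose Z := <[z]>%G.
have nZ x : x \in 'N(Z).
  have : x \in 'C[z] by apply/cent1P; exact: cz.
  by rewrite -cent_cycle; apply: fintype.subsetP; exact: cent_sub.
have nZT : Z <| [set: A]%SET.
  by rewrite /normal finset.subsetT; apply/fintype.subsetP => x _; exact: nZ.
have Z1 : (Z : {set A}) != 1%g.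
  by rewrite -cardG_gt1 -[#|_|]/#[z] oz prime_gt1.
have Fp : (Zp_trunc (pdiv p)).+2 = p by rewrite Fp_cast.
have modp k : z ^+ (k %% p) = z ^+ k by rewrite -oz expg_mod_order.
exists (coset_of Z), (coset Z), (fun a : 'F_p => z ^+ a); split; split.
- have := ltn_quotient Z1 (finset.subsetT Z).
  have -> : ([set: A]%SET / Z)%g = [set: coset_of Z]%SET.
    apply/setP => C; rewrite finset.in_setT; have [x _ ->] := cosetP C.
    by rewrite mem_quotient ?finset.in_setT.
  by rewrite !cardsT.
- have -> : [set: coset_of Z]%SET = ([set: A]%SET / Z)%g.
    apply/setP => C; rewrite finset.in_setT; have [x _ ->] := cosetP C.
    by rewrite mem_quotient ?finset.in_setT.
  exact: quotient_pgroup.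
- by move=> x y; rewrite morphM ?nZ.
- by move=> C; have [x _ ->] := cosetP C; exists x.
- by move=> a b; rewrite -expgD -[RHS]modp; congr (z ^+ _); exact: (congr1 (modn (a + b)) Fp).
- move=> a b /eqP; rewrite eq_expg_mod_order oz.
  have lt (c : 'F_p) : c < p by rewrite -[X in _ < X]Fp ltn_ord.
  by rewrite !modn_small ?lt // => /eqP/val_inj.
- by move=> a x; apply/commute_sym/commuteX.
- move=> x /(coset_idr (nZ x))/cycleP[k ->]; exists (inZp k).
  by rewrite -[LHS]modp; congr (z ^+ _); exact/esym/(congr1 (modn k) Fp).
by move=> a; rewrite coset_id // mem_cycle.
Qed.

Lemma natr_Fp (p : nat) (a : 'F_p) : ((a : nat)%:R)%R = a.
Proof. exact: natr_Zp. Qed.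

Definition is_char (p : nat) (P : topGroupType) (chi : P -> 'F_p) : Prop :=
  (forall x y, chi (x * y) = (chi x + chi y)%R) /\ nbhs 1 [set x | chi x = 0%R].

(** * Dual systems and the universal property *)

(** The map [i] is the candidate basis and [chi] its coordinate functions. [i_gen] expresses
    topological generation as seen by characters, and [dual] allows a homomorphism to be adjusted at
    one basis element without affecting the others. *)
Section DualSystem.
Variables (p : nat) (P : topGroupType) (X : choiceType) (chi : X -> P -> 'F_p) (i : X -> P).
Hypotheses (pr : prime p) (pP : pro_p p P) (epP : cts_ep p P).
Hypothesis chiP : forall x, is_char (chi x).
Hypothesis dual : forall x y, chi x (i y) = ((x == y)%:R)%R.
Hypothesis i_conv : forall N, open_normal N -> finite_set [set x | ~ N (i x)].
Hypothesis i_gen : forall psi : P -> 'F_p, is_char psi ->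
  (forall x, psi (i x) = 0%R) -> forall g, psi g = 0%R.

Let proP : profinite P. Proof. by case: pP. Qed.

(** Two homomorphisms that agree modulo a central F_p differ by a map to F_p, which is a character
    by centrality; it vanishes on the image of i, hence everywhere by [i_gen]. *)
Lemma dual_system_uniq (A : finGroupType) (psi1 psi2 : P -> A) :
  p.-group [set: A]%SET -> cts_hom psi1 -> cts_hom psi2 ->
  (forall x, psi1 (i x) = psi2 (i x)) -> psi1 =1 psi2.
Proof.
have [n] := ubnP #|A|; elim: n A psi1 psi2 => // n IH A psi1 psi2 /ltnSE An pA c1 c2 e12.
have [A1|A1] := leqP #|A| 1; first by move=> g; exact: (fintype_le1P A1).
have [C [q [e [[CA pC qM qS] [eM eI eC eK qe]]]]] := pgroup_central_layer pr pA A1.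
have [[M1 n1] [M2 n2]] := (c1, c2).
have cq psi : cts_hom psi -> cts_hom (q \o psi : P -> C).
  move=> [M n0]; split=> [x y|]; first by rewrite /= M qM.
  by apply: filterS n0 => x /= ->; exact: morph_of1.
have e12q : q \o psi1 =1 q \o psi2.
  apply: IH => //; [exact: leq_trans CA An|exact: cq|exact: cq|].
  by move=> x /=; rewrite e12.
have hc g : exists a, (psi1 g)^-1 * psi2 g = e a.
  apply: eK; rewrite qM morph_ofV //.
  by rewrite -[q (psi2 g)]/((q \o psi2) g) -e12q mulVg.
have [c cP] := choice hc.
have e0 : e 0%R = 1 by apply: (@mulgI _ (e 0%R)); rewrite -eM addr0 mulg1.
have cc : is_char c.
  split=> [x y|]; last first.
    apply: filterS (filterI n1 n2) => x [/= e1 e2]; apply: eI.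
    by rewrite -cP e1 e2 invg1 mul1g e0.
  apply: eI; rewrite eM -[LHS]cP M1 M2 invgM -mulgA (mulgA _ (psi2 x)) cP.
  by rewrite mulgA -(eC (c x)) -mulgA cP.
move=> g; have := cP g; rewrite (i_gen cc) ?e0 => [|x].
  by move=> e1; rewrite -[LHS]mulg1 -e1 mulVKg.
by apply: eI; rewrite -cP e12 mulVg e0.
Qed.

(** Solve the problem modulo a central F_p, lift the solution by projectivity, and correct the
    central error at the finitely many basis elements where it occurs. *)
Lemma dual_system_lift (A : finGroupType) (f : X -> A) :
  p.-group [set: A]%SET -> finite_set [set x | f x <> 1] ->
  exists2 psi : P -> A, cts_hom psi & forall x, psi (i x) = f x.
Proof.
have [n] := ubnP #|A|; elim: n A f => // n IH A f /ltnSE An pA finf.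
have [A1|A1] := leqP #|A| 1.
  exists (fun=> 1); last by move=> x; exact: (fintype_le1P A1).
  split=> [x y|]; first by rewrite mulg1.
  by apply: (@filterS _ (nbhs (1 : P)) _ setT) filterT => x.
have [C [q [e [[CA pC qM qS] [eM eI eC eK qe]]]]] := pgroup_central_layer pr pA A1.
have [|psi0 psi0c psi0P] := IH C (q \o f) (leq_trans CA An) pC.
  apply: sub_finite_set finf => x /= qf fx; apply: qf; rewrite fx.
  exact: morph_of1.
have [psi psic psiP] := epP pA qM qS psi0c.
have e0 : e 0%R = 1 by apply: (@mulgI _ (e 0%R)); rewrite -eM addr0 mulg1.
(* Outside a finite set both sides are 1, by convergence of i and finiteness of the support of f. *)
have [s sP] : exists s : seq X, forall x, x \notin s -> psi (i x) = f x.
  have [N [oN Npsi]] := open_normal_basis proP psic.2.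
  have : finite_set ([set x | ~ N (i x)] `|` [set x | f x <> 1]).
    by rewrite finite_setU; split=> //; exact: i_conv.
  move=> /finite_seqP[s sE]; exists s => x xs.
  have nx : ~ ([set x | ~ N (i x)] `|` [set x | f x <> 1]) x.
    by rewrite sE /= => xs'; rewrite xs' in xs.
  have Nx : N (i x) by apply: contrapT => h; apply: nx; left.
  have fx : f x = 1 by apply: contrapT => h; apply: nx; right.
  by rewrite fx; exact: Npsi.
have psif x : q (psi (i x)) = q (f x) by rewrite psiP psi0P.
elim: s psi psic psif sP {psiP} => [|y s IHs] psi [psiM psi1] psif sP.
  by exists psi => // x; exact: sP.
have [c cP] : exists c, (psi (i y))^-1 * f y = e c.
  by apply: eK; rewrite qM morph_ofV // psif mulVg.
have [chiM chi1] := chiP y.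
(* By duality the factor is the missing e c at i y and is trivial at every other i x. *)
apply: (IHs (fun g => psi g * e (c * chi y g)%R)).
- split=> [g h|].
    rewrite psiM chiM mulrDr eM -!mulgA; congr (_ * _).
    by rewrite !mulgA (eC _ (psi h)).
  apply: filterS (filterI psi1 chi1) => g [/= -> ->].
  by rewrite mulr0 e0 mulg1.
- by move=> x; rewrite qM qe mulg1.
move=> x xs; rewrite dual; have [<-|yx] := eqVneq y x.
  by rewrite mulr1 -cP mulVKg.
by rewrite mulr0 e0 mulg1; apply: sP; rewrite inE negb_or eq_sym yx.
Qed.

Section UniversalProperty.
Variables (H : topGroupType) (f : X -> H).
Hypotheses (pH : pro_p p H).
Hypothesis f_conv : forall N, open_normal N -> finite_set [set x | ~ N (f x)].

Let proH : profinite H. Proof. by case: pH. Qed.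

(** Openness is a premise inside the existential, so that psi is a family over all of
    [fin_normal H]; only its members at open N carry information. *)
Let psi_ex (N : fin_normal H) : exists psi : P -> quot N, open (N : set H) ->
  cts_hom psi /\ forall x, psi (i x) = to_quot N (f x).
Proof.
have [oN|nN] := pselect (open (N : set H)); last by exists (fun=> 1).
have [|psi psic psiE] :=
  @dual_system_lift (quot N) (fun x => to_quot N (f x)) (pro_p_quot pr pH oN).
  apply: sub_finite_set (f_conv (conj (fin_normalP N) oN)) => x /= nx Nx; apply: nx.
  by apply/esym/to_quot_eq; rewrite invg1 mul1g.
by exists psi.
Qed.

Let psi (N : fin_normal H) : P -> quot N := sval (cid (psi_ex N)).

Let psic (N : fin_normal H) : open (N : set H) -> cts_hom (@psi N).
Proof. by move=> oN; have [] := svalP (cid (psi_ex N)) oN. Qed.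

Let psiE (N : fin_normal H) x : open (N : set H) -> psi N (i x) = to_quot N (f x).
Proof. by move=> oN; have [_] := svalP (cid (psi_ex N)) oN; apply. Qed.

(** The reduction of psi M modulo N and psi N agree on the image of i, so they are equal by
    [dual_system_uniq]. *)
Let psi_compat (M N : fin_normal H) h g : open (M : set H) -> open (N : set H) ->
  (M : set H) `<=` N -> to_quot M h = psi M g -> to_quot N h = psi N g.
Proof.
move=> oM oN MN e; pose r (C : quot M) : quot N := to_quot N (quot_repr C).
have rE k : r (to_quot M k) = to_quot N k.
  apply/esym/to_quot_eq/MN/to_quot_eq.
  by rewrite quot_reprK.
have rM : {morph r : x y / x * y}.
  move=> C D; have [a <-] := to_quot_ex C; have [b <-] := to_quot_ex D.
  by rewrite -[_ * _]to_quotM !rE to_quotM.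
have cr : cts_hom (r \o psi M).
  have [psiM psi1] := psic oM; split=> [x y|]; first by rewrite /= psiM rM.
  by apply: filterS psi1 => x /= ->; exact: morph_of1.
rewrite -rE e -[LHS]/((r \o psi M) g).
apply: (dual_system_uniq (pro_p_quot pr pH oN) cr (psic oN)) => x.
by rewrite /= !psiE // rE.
Qed.

Let fin_normal_bigI_open (s : seq (fin_normal H)) : exists M : fin_normal H, open (M : set H) /\
  forall N, N \in s -> open (N : set H) -> (M : set H) `<=` N.
Proof.
have [cH _ _] := proH.
suff [M [oM MP]] : exists M : set H, open_normal M /\
    forall N, N \in s -> open (N : set H) -> M `<=` N.
  exists (open_fin_normal cH oM); split; first exact: oM.2.
  exact: MP.
elim: s => [|K s [M [oM MP]]];
    first by exists setT; split=> //; exact: open_normalT.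
have [oK|nK] := pselect (open (K : set H)); last first.
  by exists M; split=> // N; rewrite inE => /predU1P[->//|/MP].
exists (M `&` K); split; first by apply: open_normalI => //; split=> //; exact: fin_normalP.
by move=> N; rewrite inE => /predU1P[-> _ x []|/MP MN /MN {}MN x [/MN]].
Qed.

(** Compatible classes modulo all open normal subgroups are realised by a point of H: the conditions
    are closed, and finitely many of them follow from one at a smaller open M. *)
Let fbar_ex g : exists h, forall N : fin_normal H, open (N : set H) -> to_quot N h = psi N g.
Proof.
have [cH _ _] := proH.
pose C (N : fin_normal H) := [set h | open (N : set H) -> to_quot N h = psi N g].
have clC N : closed (C N).
  have [oN|nN] := pselect (open (N : set H)); last first.
    have -> : C N = setT by apply/seteqP; split=> // h _ /nN.
    exact: closedT.
  rewrite -openC openE => h nCh.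
  have nN := open_normal_nbhs (conj (fin_normalP N) oN).
  apply: filterS (nbhs_mulgl h nN) => k /= /to_quot_eq e Ck; apply: nCh => _.
  by rewrite e; exact: Ck.
apply: (compact_fip cH clC) => s.
have [M [oM MP]] := fin_normal_bigI_open s; have [h hP] := to_quot_ex (psi M g).
by exists h => N Ns oN; apply: (psi_compat oM oN) hP; exact: MP.
Qed.

Lemma dual_system_universal : exists! fbar : P -> H,
  [/\ continuous fbar, {morph fbar : x y / x * y} & forall x, fbar (i x) = f x].
Proof.
have [cH _ _] := proH; have [fbar fbarP] := choice fbar_ex.
have sep (x y : H) :
    (forall N : fin_normal H, open (N : set H) -> to_quot N x = to_quot N y) -> x = y.
  move=> xy; rewrite -[y](mulKVg x) (_ : x^-1 * y = 1) ?mulg1 //.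
  apply: open_normal_sep => // N oN; pose M := open_fin_normal cH oN.
  by apply: (iffLR (@to_quot_eq _ M x y)); apply: xy; exact: oN.2.
exists fbar; split; first split.
- move=> g U; rewrite -[fbar g]mulg1 => nU.
  have n1 : nbhs (1 : H) [set y | U (fbar g * y)] by exact: (@continuous_mulgl _ (fbar g) 1).
  have [N [oN NU]] := open_normal_basis proH n1; pose M := open_fin_normal cH oN.
  have := @discrete_nbhs _ (quot M) _ g (cts_hom_continuous (psic (N := M) oN.2)).
  apply: (@filterS _ (nbhs g)) => k /= e.
  rewrite -[fbar k](mulKVg (fbar g)); apply: NU.
  apply: (iffLR (@to_quot_eq _ M _ _)).
  by rewrite !fbarP //; exact: oN.2.
- move=> x y; apply: sep => N oN; rewrite to_quotM !fbarP //.
  by have [-> _] := psic oN.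
- by move=> x; apply: sep => N oN; rewrite fbarP // psiE.
move=> f' [f'c f'M f'E]; apply/funext => g; apply: sep => N oN; rewrite fbarP //.
have cf' : cts_hom (to_quot N \o f').
  split=> [x y|]; first by rewrite /= f'M to_quotM.
  have nN := open_normal_nbhs (conj (fin_normalP N) oN).
  have := f'c 1 N; rewrite morph_of1 // => /(_ nN).
  apply: (@filterS _ (nbhs (1 : P))) => x /= Nx.
  by apply/esym/to_quot_eq; rewrite invg1 mul1g.
apply: (dual_system_uniq (pro_p_quot pr pH oN) (psic oN) cf') => x.
by rewrite psiE //= f'E.
Qed.

End UniversalProperty.

End DualSystem.

(** * Construction of a convergent dual system *)

(** [well_order] provides only unique least elements of nonempty subsets; the order axioms are
    recovered from subsets with at most three elements. *)
Lemma well_order_strict (I : eqType) (R : rel I) : well_order R ->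
  let lt a b := R a b /\ a <> b in
  [/\ well_founded lt, forall a b, [\/ lt a b, a = b | lt b a]
    & forall a b c, lt a b -> lt b c -> lt a c].
Proof.
move=> wo lt.
have min2 (a b c : I) : exists z, [/\ z = a \/ z = b \/ z = c, R z a, R z b & R z c].
  have [|z [[zA lb] _]] := wo [pred x | [|| x == a, x == b | x == c]].
    by exists a; rewrite !inE eqxx.
  exists z; split; try by apply: lb; rewrite !inE eqxx ?orbT.
  by move: zA; rewrite !inE => /or3P[] /eqP ->; [left|right; left|right; right].
have refl a : R a a by have [z [[->|[->|->]] ]] := min2 a a a.
have total a b : R a b \/ R b a.
  by have [z [[->|[->|->]] ? ? ?]] := min2 a b b; [left|right|right].
have anti a b : R a b -> R b a -> a = b.
  move=> ab ba; have [|z [_ zU]] := wo [pred x | (x == a) || (x == b)].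
    by exists a; rewrite !inE eqxx.
  rewrite -(zU a) ?(zU b) //; split; rewrite ?inE ?eqxx ?orbT // => x;
    by rewrite !inE => /orP[] /eqP ->.
have trans a b c : R a b -> R b c -> R a c.
  move=> ab bc; have [z [[->|[->|->]] za zb zc]] := min2 a b c => //.
    by rewrite (anti a b).
  by rewrite -(anti b c).
split.
- move=> a; apply: contrapT => na.
  have [|b [[]]] := wo [pred x | ~~ `[< Acc lt x >]].
    by exists a; rewrite inE; apply/asboolPn.
  rewrite inE => /asboolPn nb lb _; apply: nb; apply: Acc_intro => c [cb ne].
  apply: contrapT => nc; apply: ne; apply: anti => //.
  by apply: lb; rewrite inE; apply/asboolPn.
- move=> a b; have [->|ab] := pselect (a = b); first by constructor 2.
  have [?|?] := total a b; first by constructor 1.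
  by constructor 3; split=> // e; apply: ab.
move=> a b c [ab nab] [bc nbc]; split; first exact: trans bc.
by move=> ac; apply: nab; apply: anti => //; rewrite ac.
Qed.

(* A lexicographic choice: f lies in N a as soon as some point of F that agrees
   with f on all earlier members of the family does. *)
Lemma greedy_point (T : topologicalType) (I : eqType) (lt : I -> I -> Prop)
    (N : I -> set T) (F : set T) :
  compact [set: T] -> well_founded lt -> (forall a b, [\/ lt a b, a = b | lt b a]) ->
  (forall a b c, lt a b -> lt b c -> lt a c) ->
  (forall a, closed (N a)) -> closed F -> F !=set0 ->
  exists f, F f /\ forall a,
    (exists y, [/\ F y, N a y & forall b, lt b a -> N b f -> N b y]) -> N a f.
Proof.
move=> cT wf tri tr clN clF [y0 Fy0].
(* Well-founded recursion decides which conditions are imposed: a is retained when some point of F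
   satisfies N a together with all N b retained before. *)
pose step a (rec : forall b, lt b a -> Prop) : Prop :=
  exists y, [/\ F y, N a y & forall b (ba : lt b a), rec b ba -> N b y].
pose A := Fix wf (fun _ => Prop) step.
have AE a : A a = exists y, [/\ F y, N a y & forall b, lt b a -> A b -> N b y].
  rewrite /A Fix_eq // => x g h gh; congr step.
  by apply: functional_extensionality_dep => b; apply: functional_extensionality_dep => ?; exact: gh.
pose C (o : option I) := if o is Some a then [set x | A a -> N a x] else F.
have clC o : closed (C o).
  case: o => [a|] //=; have [Aa|nA] := pselect (A a).
    by have -> : [set x | A a -> N a x] = N a;
      [apply/seteqP; split=> x; [apply|move=> ? _]|exact: clN].
  by have -> : [set x | A a -> N a x] = setT;
    [apply/seteqP; split=> // x _ /nA|exact: closedT].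
have [s|f fP] := @compact_fip T _ C cT clC.
  (* m is the greatest retained index in s, if there is one; the point witnessing its retention also
     satisfies the earlier retained conditions. *)
  have [m mP] : exists m, forall a, Some a \in s -> A a ->
      exists2 m', m = Some m' & A m' /\ (lt a m' \/ a = m').
    elim: s => [|o s [m mP]]; first by exists None.
    case: o => [a|]; last by exists m => b; rewrite inE => /mP.
    have [Aa|nA] := pselect (A a); last first.
      by exists m => b; rewrite inE => /predU1P[[->]/nA//|/mP].
    case: m mP => [m|] mP; last first.
      exists (Some a) => b; rewrite inE => /predU1P[[->] _|bs Ab].
        by exists a => //; split=> //; right.
      by have [m'] := mP b bs Ab.
    have [am|ma] : (A m /\ lt a m) \/ (A m -> lt m a \/ m = a).
      have [Am|nAm] := pselect (A m); last by right.
      by case: (tri a m) => ?; [left|right; right|right; left].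
      exists (Some m) => b; rewrite inE => /predU1P[[->] _|bs Ab]; last exact: mP.
      by exists m => //; case: am => Am am; split=> //; left.
    exists (Some a) => b; rewrite inE => /predU1P[[->] _|bs Ab].
        by exists a => //; split=> //; right.
    have [m' [<-] [Am bm]] := mP b bs Ab; exists a => //; split=> //.
    by case: bm (ma Am) => [bm [ma'|<-]|-> [?|->]]; [left; exact: tr ma'|left|left|right].
  case: m mP => [m|] mP.
    have [Am|nA] := pselect (A m).
      have := Am; rewrite AE => -[y [Fy Ny yP]]; exists y => -[a|] //= aS Aa.
      by have [_ [<-] [_ [am|->]]] := mP a aS Aa; [exact: yP|].
    by exists y0 => -[a|] //= aS Aa; have [_ [<-] []] := mP a aS Aa.
  by exists y0 => -[a|] //= aS Aa; have [] := mP a aS Aa.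
exists f; split; first exact: (fP None).
move=> a [y [Fy Ny yP]]; apply: (fP (Some a)); rewrite AE; exists y; split=> // b ba Ab.
by apply: yP => //; exact: (fP (Some b)).
Qed.

Section Characters.
Variables (p : nat) (P : topGroupType).
Hypothesis pP : pro_p p P.
Implicit Types (chi psi : P -> 'F_p) (X : set (P -> 'F_p)).

Let proP : profinite P. Proof. by case: pP. Qed.
Let cP : compact [set: P]. Proof. by case: proP. Qed.

Lemma char1 chi : is_char chi -> chi 1 = 0%R.
Proof. by move=> [M _]; apply: (@addrI _ (chi 1)); rewrite -M mulg1 addr0. Qed.

Lemma charV chi x : is_char chi -> chi x^-1 = (- chi x)%R.
Proof.
move=> c; have [M _] := c; apply: (@addrI _ (chi x)).
by rewrite -M mulgV subrr char1.
Qed.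

Lemma charX chi x n : is_char chi -> chi (x ^+ n) = (n%:R * chi x)%R.
Proof.
move=> c; have [M _] := c; elim: n => [|n IH]; first by rewrite expg0 mul0r char1.
by rewrite expgS M IH mulrS mulrDl mul1r.
Qed.

Lemma closed_char chi a : is_char chi -> closed [set g | chi g = a].
Proof.
move=> c; have [M n0] := c; rewrite -openC openE => g nga.
apply: filterS (nbhs_mulgl g n0) => h /=; rewrite M charV // => e ha; apply: nga.
by rewrite /= -ha; apply/eqP; rewrite eq_sym -subr_eq0 addrC e.
Qed.

Lemma char_kernel_open chi : is_char chi -> open [set g | chi g = 0%R].
Proof.
move=> c; have [M n0] := c; apply: subgroup_open => //; split=> [|x y|x]; rewrite /mkset.
- exact: char1.
- by rewrite M => -> ->; rewrite addr0.
- by rewrite charV // => ->; rewrite oppr0.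
Qed.

Definition dual_at X chi : set P := [set g | forall psi, X psi -> psi g = ((psi == chi)%:R)%R].

(** Linear independence over F_p in dual form: by compactness of P it amounts to the existence of
    dual elements. *)
Definition independent X : Prop :=
  X `<=` @is_char p P /\ forall chi, X chi -> dual_at X chi !=set0.

(** Duality is a family of closed conditions on g, and finitely many of them concern a single member
    of the chain; compactness gives the dual element needed for Zorn's lemma. *)
Lemma independent_bigcup (F : set (set (P -> 'F_p))) :
  F `<=` independent -> total_on F subset -> independent (\bigcup_(X in F) X).
Proof.
move=> FI tF; split=> [chi [X /FI[Xc _]] /Xc //|chi [X0 FX0 X0chi]].
pose C (psi : P -> 'F_p) := [set g | (\bigcup_(X in F) X) psi -> psi g = ((psi == chi)%:R)%R].
have clC psi : closed (C psi).
  have [Fpsi|nF] := pselect ((\bigcup_(X in F) X) psi); last first.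
    have -> : C psi = setT by apply/seteqP; split=> // g _ /nF.
    exact: closedT.
  have -> : C psi = [set g | psi g = ((psi == chi)%:R)%R].
    by apply/seteqP; split=> g; [apply|move=> ? _].
  by apply: closed_char; case: Fpsi => X /FI[Xc _] /Xc.
have [s|g gP] := compact_fip cP clC; last by exists g.
have [X1 [FX1 X01 X1P]] : exists X1, [/\ F X1, X0 `<=` X1 &
    forall psi, psi \in s -> (\bigcup_(X in F) X) psi -> X1 psi].
  elim: s => [|psi s [X1 [FX1 X01 X1P]]]; first by exists X0; split.
  have [[X FX Xpsi]|nF] := pselect ((\bigcup_(X in F) X) psi); last first.
    by exists X1; split=> // psi'; rewrite inE => /predU1P[->//|/X1P].
  have [XX|XX] := tF _ _ FX FX1.
    by exists X1; split=> // psi'; rewrite inE => /predU1P[-> _|/X1P//]; exact: XX.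
  exists X; split=> // [psi' /X01/XX//|psi']; rewrite inE => /predU1P[->//|/X1P h /h].
  exact: XX.
have [g gP] := (FI _ FX1).2 chi (X01 _ X0chi).
by exists g => psi psis Fpsi; apply: gP; exact: X1P.
Qed.

Lemma maximal_independent : exists X, independent X /\
  forall chi, is_char chi -> (forall g, (forall psi, X psi -> psi g = 0%R) -> chi g = 0%R).
Proof.
have [X [iX maxX]] := Zorn_bigcup independent_bigcup.
exists X; split=> // chi c g0 g0P; apply: contrapT => /eqP chig0.
have [Xc Xd] := iX.
(* X vanishes at g1 and chi is 1 there: g1 is dual to chi, and its powers correct the old dual
   elements so that chi vanishes on them. Thus chi could be added to X. *)
pose g1 := g0 ^+ ((chi g0)^-1 : 'F_p)%R.
have chig1 : chi g1 = 1%R by rewrite charX // natr_Fp mulVf.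
have g1P psi : X psi -> psi g1 = 0%R.
  by move=> Xpsi; rewrite (charX _ _ (Xc _ Xpsi)) (g0P psi Xpsi) mulr0.
have nX : ~ X chi by move=> /g0P e; rewrite e eqxx in chig0.
apply: (maxX (X `|` [set chi])).
  split; first by move=> psi Xpsi; left.
  by move=> h; apply: nX; apply: h; right.
split=> [psi [/Xc|->] //|psi [Xpsi|->]].
  have [g gP] := Xd psi Xpsi.
  have nchi : (chi == psi) = false by apply/negP => /eqP e; apply: nX; rewrite e.
  exists (g * g1 ^+ (- chi g : 'F_p)%R) => xi [Xxi|->].
    have [M _] := Xc _ Xxi; rewrite M (charX _ _ (Xc _ Xxi)) (g1P xi Xxi) mulr0 addr0.
    exact: gP.
  by have [M _] := c; rewrite M charX // natr_Fp chig1 mulr1 subrr nchi.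
exists g1 => xi [Xxi|->]; last by rewrite eqxx.
rewrite (g1P xi Xxi); have -> : (xi == chi) = false; last by [].
by apply/negP => /eqP e; apply: nX; rewrite -e.
Qed.

Lemma closed_dual_at X chi : X `<=` @is_char p P -> closed (dual_at X chi).
Proof.
move=> Xc; have -> : dual_at X chi = \bigcap_(psi in X) [set g | psi g = ((psi == chi)%:R)%R].
  by apply/seteqP; split.
by apply: closed_bigI => psi Xpsi; apply: closed_char; exact: Xc.
Qed.

(* The greedy choice among the dual elements, for a well-ordering of the open
   normal subgroups: by induction along this order, each of them contains the
   chosen element for almost all chi. *)
Lemma convergent_dual X : independent X ->
  exists f : (P -> 'F_p) -> P, (forall chi, X chi -> dual_at X chi (f chi)) /\
    forall N, open_normal N -> finite_set [set chi | X chi /\ ~ N (f chi)].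
Proof.
move=> [Xc Xd].
have [lt [wf tri tr]] : exists lt : {classic set P} -> {classic set P} -> Prop,
    [/\ well_founded lt, forall a b, [\/ lt a b, a = b | lt b a]
      & forall a b c, lt a b -> lt b c -> lt a c].
  have [R /well_order_strict[]] := well_ordering_principle {classic set P}.
  by exists (fun a b => R a b /\ a <> b).
(* Sets that are not open normal subgroups impose no condition. *)
pose N (V : {classic set P}) : set P := [set g | open_normal (V : set P) -> (V : set P) g].
have NE V : open_normal V -> N V = V.
  by move=> oV; apply/seteqP; split=> g; [apply|move=> ? _].
have clN V : closed (N V).
  have [oV|nV] := pselect (open_normal (V : set P)).
    by rewrite NE //; exact: open_normal_closed.
  have -> : N V = setT by apply/seteqP; split=> // g _ /nV.
  exact: closedT.
have hf chi : exists f, X chi -> dual_at X chi f /\ forall a,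
    (exists y, [/\ dual_at X chi y, N a y & forall b, lt b a -> N b f -> N b y]) -> N a f.
  have [Xchi|nX] := pselect (X chi); last by exists 1.
  have [f fP] := greedy_point cP wf tri tr clN (@closed_dual_at X chi Xc) (Xd _ Xchi).
  by exists f.
have [f fP] := choice hf; exists f; split=> [chi /fP[]//|].
suff fin (V : {classic set P}) : finite_set [set chi | X chi /\ ~ N V (f chi)].
  by move=> V oV; have := fin V; rewrite NE.
elim/(well_founded_ind wf): V => V IH.
have [oV|nV] := pselect (open_normal (V : set P)); last first.
  by apply: (@sub_finite_set _ _ set0) => // chi [_] /=; apply => /nV.
pose C (j : (P -> 'F_p) + {classic set P}) : set P := match j with
  | inl psi => [set g | X psi -> psi g = 0%R]
  | inr b => [set g | lt b V -> N b g] end.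
have clC j : closed (C j).
  case: j => [psi|b] /=.
    have [Xpsi|nX] := pselect (X psi).
      have -> : [set g | X psi -> psi g = 0%R] = [set g | psi g = 0%R].
        by apply/seteqP; split=> g; [apply|move=> ? _].
      by apply: closed_char; exact: Xc.
    have -> : [set g | X psi -> psi g = 0%R] = setT by apply/seteqP; split=> // g _ /nX.
    exact: closedT.
  have [ltb|nlt] := pselect (lt b V).
    have -> : [set g | lt b V -> N b g] = N b by apply/seteqP; split=> g; [apply|move=> ? _].
    exact: clN.
  have -> : [set g | lt b V -> N b g] = setT by apply/seteqP; split=> // g _ /nlt.
  exact: closedT.
(* The union of the cosets m V, where m ranges over the elements killed by all of X and lying in all
   open normal subgroups earlier than V. Being open, it contains a finite intersection of the sets
   [C j]. *)
pose O : set P := [set h | exists m, (forall j, C j m) /\ (V : set P) (m^-1 * h)].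
have [[V1 VM VV VJ] opV] := oV.
have opO : open O.
  rewrite openE => h [m [Cm Vmh]].
  apply: filterS (nbhs_mulgl h (open_normal_nbhs oV)) => k /= Vhk; exists m; split=> //.
  by rewrite -[k](mulKVg h) mulgA; exact: VM.
have CO m : (forall j, C j m) -> O m by move=> Cm; exists m; split=> //; rewrite mulVg.
have [s sP] := compact_subset_open cP clC opO CO.
(* By duality the condition that psi vanishes can fail only for chi = psi; the condition of an
   earlier subgroup fails finitely often by induction. *)
have finC : finite_set [set chi | X chi /\ exists2 j, j \in s & ~ C j (f chi)].
  elim: (s) => [|j t IHt].
    by apply: (@sub_finite_set _ _ set0) => // chi [_ []].
  have fj : finite_set [set chi | X chi /\ ~ C j (f chi)].
    case: j => [psi|b] /=.
      apply: (@sub_finite_set _ _ [set psi]); last exact: finite_set1.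
      move=> chi [Xchi nC]; apply: contrapT => nchi; apply: nC => Xpsi.
      rewrite ((fP chi Xchi).1 psi Xpsi).
      by have -> : (psi == chi) = false by apply/negP => /eqP e; apply: nchi; rewrite /= e.
    have [ltb|nlt] := pselect (lt b V).
      by apply: sub_finite_set (IH b ltb) => chi [Xchi nC]; split=> // Nb; apply: nC.
    by apply: (@sub_finite_set _ _ set0) => // chi [_]; apply => /nlt.
  have fU : finite_set ([set chi | X chi /\ ~ C j (f chi)] `|`
      [set chi | X chi /\ exists2 j, j \in t & ~ C j (f chi)]) by rewrite finite_setU.
  apply: sub_finite_set fU => chi [Xchi [k]]; rewrite inE => /predU1P[->|kt] nC; first by left.
  by right; split=> //; exists k.
apply: sub_finite_set finC => chi [Xchi nN]; split=> //; apply: contrapT => allC.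
have [m [Cm Vm]] : O (f chi).
  by apply: sP => j js; apply: contrapT => nC; apply: allC; exists j.
have [fd fg] := fP chi Xchi.
(* Dividing by m keeps the values of the characters in X and the membership in earlier subgroups,
   and gives an element of V; the greedy rule then puts f chi itself in V. *)
apply: nN; apply: fg; exists (m^-1 * f chi); split.
- move=> psi Xpsi; have cpsi := Xc _ Xpsi; have [M _] := cpsi.
  have /= m0 := Cm (inl psi); rewrite M charV // m0 // oppr0 add0r.
  exact: fd.
- by rewrite NE.
move=> b ltb Nb ob; have [[b1 bM bV bJ] _] := ob.
by apply: bM; [apply: bV; exact: (Cm (inr b) ltb ob)|exact: Nb].
Qed.

(** The kernel of chi is open, so the vanishing of finitely many members of X already forces chi to
    vanish. Powers of the corresponding dual elements kill these members at g without changing chi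
    g. *)
Lemma dual_generates X (f : (P -> 'F_p) -> P) chi : independent X ->
  (forall psi, X psi -> dual_at X psi (f psi)) ->
  is_char chi -> (forall g, (forall psi, X psi -> psi g = 0%R) -> chi g = 0%R) ->
  (forall psi, X psi -> chi (f psi) = 0%R) -> forall g, chi g = 0%R.
Proof.
move=> [Xc _] fd c chiX chif g; have [M _] := c.
pose C (psi : P -> 'F_p) := [set g | X psi -> psi g = 0%R].
have clC psi : closed (C psi).
  have [Xpsi|nX] := pselect (X psi).
    have -> : C psi = [set g | psi g = 0%R] by apply/seteqP; split=> h; [apply|move=> ? _].
    by apply: closed_char; exact: Xc.
  have -> : C psi = setT by apply/seteqP; split=> // h _ /nX.
  exact: closedT.
have [s sP] := compact_subset_open cP clC (char_kernel_open c) chiX.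
suff [h [<- hP]] : exists h, chi h = chi g /\ forall psi, psi \in s -> X psi -> psi h = 0%R.
  by apply: sP => psi psis Xpsi; exact: hP.
elim: s {sP} => [|psi s [h [he hP]]]; first by exists g.
have [Xpsi|nX] := pselect (X psi); last first.
  by exists h; split=> // xi; rewrite inE => /predU1P[->//|/hP].
exists (h * f psi ^+ (- psi h : 'F_p)%R); split.
  by rewrite M charX // chif // mulr0 addr0.
move=> xi xis Xxi; have cxi := Xc _ Xxi; have [Mxi _] := cxi.
rewrite Mxi charX // natr_Fp (fd psi Xpsi xi Xxi).
have [->|ne] := eqVneq xi psi; first by rewrite mulr1 subrr.
rewrite mulr0 addr0; apply: hP => //.
by move: xis; rewrite inE (negPf ne).
Qed.

End Characters.

Lemma discrete_compact_finite (X : discreteTopologicalType) (A : set X) :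
  compact A -> finite_set A.
Proof.
move=> cA; apply: contrapT => infA.
pose F : set_system X := [set B | finite_set (A `\` B)].
have FF : ProperFilter F.
  split; first by rewrite /F /mkset setD0.
  split=> [|B C FB FC|B C BC FB]; rewrite /F /mkset.
  - by rewrite setDT; exact: finite_set0.
  - by rewrite setDIr finite_setU.
  by apply: sub_finite_set FB => x [Ax nC]; split=> // /BC.
have [|x [_ Fx]] := cA F FF; first by rewrite /F /mkset setDv; exact: finite_set0.
have [|y [/= ny yx]] := Fx (~` [set x]) [set x] _ (discrete_set1 x); last exact: ny.
apply: (@sub_finite_set _ _ [set x]); last exact: finite_set1.
by move=> y [_ /= /contrapT].
Qed.

(** The basis is a convergent family of dual elements, indexed by a maximal independent set of
    characters with the discrete topology. *)
Theorem cts_ep_free (p : nat) (P : topGroupType) :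
  prime p -> pro_p p P -> cts_ep p P -> free_pro_p p P.
Proof.
move=> pr pP epP; have proP : profinite P by case: pP.
have [X [iX maxX]] := maximal_independent pP.
have [f [fd fconv]] := convergent_dual pP iX.
pose Y := discrete_topology (set_type X).
have YX (x : Y) : X (val (x : set_type X)) := set_valP (x : set_type X).
pose i (x : set_type X) : P := f (val x).
have fin (A : set (set_type X)) :
    finite_set [set chi | exists2 x, A x & val x = chi] -> finite_set A.
  have vI : {in A &, injective (val : set_type X -> _)} by move=> x y _ _; exact: val_inj.
  by rewrite -(eq_finite_set (inj_card_eq vI)).
have iconv N : open_normal N -> finite_set [set x | ~ N (i x)].
  move=> oN; apply: fin; apply: sub_finite_set (fconv N oN) => _ [x nN <-].
  by split=> //; exact: YX.
have chiP (x : set_type X) : is_char (val x) by apply: iX.1; exact: YX.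
have dual (x y : set_type X) : val x (i y) = ((x == y)%:R)%R.
  by rewrite (fd _ (YX y) _ (YX x)) val_eqE.
have igen (psi : P -> 'F_p) : is_char psi -> (forall x, psi (i x) = 0%R) -> forall g, psi g = 0%R.
  move=> c ipsi; apply: (dual_generates pP iX fd c (maxX psi c)) => chi Xchi.
  exact: (ipsi (SigSub (mem_set Xchi))).
pose j (o : one_point_compactification Y) : P := if o is Some x then i x else 1.
exists Y, j; split=> //.
  move=> [x|] U.
    move=> /nbhs_singleton Ux; change (nbhs (x : Y) [set y : Y | U (i y)]).
    by apply: (@filterS _ (nbhs (x : Y))) (discrete_set1 (x : Y)) => y ->.
  move=> /(open_normal_basis proP)[N [oN NU]]; exists [set x : Y | ~ N (i x)].
    by split; [exact/finite_compact/iconv|exact: discrete_closed].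
  move=> _ [[x /contrapT Nx <-]|->]; apply: NU => //.
  by case: oN => -[].
move=> H f0 pH f0c f01.
(* Continuity at the point at infinity yields convergence to 1, because compact subsets of a
   discrete space are finite. *)
have f0conv N : open_normal N -> finite_set [set x : set_type X | ~ N (f0 (Some (x : Y)))].
  move=> oN; have := f0c None N; rewrite f01 => /(_ (open_normal_nbhs oN)).
  move=> [U [cU _] UN]; apply: sub_finite_set (discrete_compact_finite cU) => x /= nN.
  by apply: contrapT => nU; apply: nN; apply: UN; left; exists x.
have [fbar [[fc fM fE] fU]] :=
  dual_system_universal pr pP epP chiP dual iconv igen pH f0conv.
exists fbar; split; first split=> //.
  by apply/funext => -[x|] /=; [rewrite fE|rewrite f01 morph_of1].
move=> g [gc gM gE]; apply: fU; split=> // x.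
by rewrite gE.
Qed.

(** * The tower of completions *)

Import Order.TTheory.
Local Open Scope order_scope.

Lemma completion_free_pro_p (p : nat) (G : groupType) :
  prime p -> abs_ep p G -> has_roots p G -> free_pro_p p (profinite_completion G).
Proof.
move=> pr epG rG; apply: cts_ep_free => //; first exact: completion_pro_p.
exact: completion_cts_ep.
Qed.

Lemma free_pro_p_abstract (p : nat) (F : topGroupType) :
  prime p -> free_pro_p p F -> abs_ep p F /\ has_roots p F.
Proof.
move=> pr fF; have pF := free_pro_p_pro_p fF; split; last exact: pro_p_roots.
by apply: pro_p_abs_ep => //; exact: free_pro_p_cts_ep.
Qed.

Theorem theorem16 (p : nat) (G : topGroupType) (d : Order.disp_t) (W : orderType d)
    (wo : well_order (<=%O : rel W)) (alpha : W) :
  prime p ->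
  free_pro_p_of_infinite_rank p G ->
  free_pro_p p (completion_of_order G wo alpha).
Proof.
move=> pr [X [i [_ fG]]].
have [wf _ _] := well_order_strict wo.
elim/(well_founded_ind wf): alpha => a IH.
(* Freeness of the earlier stages is weakened to its abstract consequences, since the direct limit
   is formed along abstract homomorphisms. *)
have {}IH b : b < a ->
    abs_ep p (completion_of_order G wo b) /\ has_roots p (completion_of_order G wo b).
  move=> ba; apply: free_pro_p_abstract => //; apply: IH; split; first exact: ltW.
  by move=> e; move: ba; rewrite e ltxx.
case: (stage_ex a) => -[a0|b ba bmax|b0 b0a nomax].
- by rewrite completion_of_order0 //; exists X, i.
- rewrite (completion_of_orderS G wo ba bmax).
  by apply: completion_free_pro_p => //; case: (IH b ba).
have [c [ca ->]] := completion_of_order_lim G wo nomax (ex_intro _ b0 b0a).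
apply: completion_free_pro_p => //.
  by apply: dirlim_abs_ep => -[b ba] /=; rewrite sys_ob_completion_system; case: (IH b ba).
by apply: dirlim_has_roots => -[b ba] /=; rewrite sys_ob_completion_system; case: (IH b ba).
Qed.
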